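(* Let $n\ge 0$ be an integer and let $\omega\ge 0$. Let $E_{n,\omega}^c=\min_{r\in\mathcal{R}_n}\|r-\exp(\omega\,\cdot)\|$ and $E_{n,\omega}^u=\min_{r\in\mathcal{U}_n}\|r-\exp(\omega\,\cdot)\|$ be the uniform errors of the Chebyshev approximation and of the unitary best approximation, respectively. If $\omega>0$, then $$\tfrac12 E_{n,\omega}^u\le E_{n,\omega}^c<E_{n,\omega}^u .$$ This includes the case $\omega\ge (n+1)\pi$, for which the Chebyshev approximant corresponds to $r^c\equiv 0$ (that is, the Chebyshev approximant is the zero function) with $E_{n,\omega}^c=1$, and all $r^u\in\mathcal{U}_n$ are unitary best approximants with $E_{n,\omega}^u=2$. Moreover, for the trivial case $\omega=0$ the best approximants $r^c\equiv r^u\equiv 1$ are exact, i.e., $E_{n,\omega}^u=E_{n,\omega}^c=0$.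
   Context: Polynomials have complex coefficients. $\mathcal{R}_n=\{p/q : p,q \text{ polynomials of degree}\le n,\ q\not\equiv 0\}$ is the set of rational functions with numerator and denominator of degree at most $n$. $\mathcal{U}_n=\{r\in\mathcal{R}_n : |r(\mathrm{i}x)|=1 \text{ for all } x\in\mathbb{R}\}$ is the set of unitary rational functions. For a complex function $g$, $\|g\|:=\max_{x\in[-1,1]}|g(\mathrm{i}x)|$, so $\|r-\exp(\omega\,\cdot)\|=\max_{x\in[-1,1]}|r(\mathrm{i}x)-\mathrm{e}^{\mathrm{i}\omega x}|$. A Chebyshev approximant is a function $r^c\in\mathcal{R}_n$ with $\|r^c-\exp(\omega\,\cdot)\|=E_{n,\omega}^c$; a unitary best approximant is a function $r^u\in\mathcal{U}_n$ with $\|r^u-\exp(\omega\,\cdot)\|=E_{n,\omega}^u$. Both minima are known to be attained. *)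

(* Defs.v *)
From mathcomp Require Import all_boot all_order all_algebra.
From mathcomp Require Import complex.
From mathcomp Require Import all_classical all_reals all_analysis.

Set Implicit Arguments.
Unset Strict Implicit.
Unset Printing Implicit Defensive.

Import Order.TTheory GRing.Theory Num.Theory.

Local Open Scope classical_set_scope.
Local Open Scope ring_scope.
Local Open Scope complex_scope.

Notation tofrac := (@FracField.tofrac _).
Notation "x %:F" := (tofrac x) : ring_scope.
Notation cabs := ComplexField.Normc.normc.

Section RationalFunctions.
Context {R : realType}.

(* A rational function is an element of the fraction field of C[X], so that
   removable singularities are removed and r = 0, r = 1 are identities of
   functions. *)
Definition ratfun := {fraction {poly R[i]}}.

(* size p <= n.+1 says that deg p <= n *)
Definition ratfun_deg_le (n : nat) : set ratfun :=
  [set r | exists p q : {poly R[i]},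
     [/\ (size p <= n.+1)%N, (size q <= n.+1)%N, q != 0 & r = p%:F / q%:F]].

Definition has_value (r : ratfun) (z v : R[i]) : Prop :=
  exists p q : {poly R[i]}, [/\ q.[z] != 0, r = p%:F / q%:F & v = p.[z] / q.[z]].

Definition regular_at (r : ratfun) (z : R[i]) : Prop := exists v, has_value r z v.

(* The value of r at z; junk value 0 when r has a pole at z. *)
Definition reval (r : ratfun) (z : R[i]) : R[i] := xget 0 (has_value r z).

Definition imag (x : R) : R[i] := 0 +i* x.

Definition unitary (n : nat) : set ratfun :=
  [set r | ratfun_deg_le n r /\
     forall x : R, regular_at r (imag x) /\ cabs (reval r (imag x)) = 1].

Definition cexp (z : R[i]) : R[i] :=
  let: a +i* b := z in (expR a * cos b) +i* (expR a * sin b).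

(* ||r - f||, equal to +oo when r has a pole on i[-1, 1]. For continuous f the
   supremum is a maximum whenever r has no such pole. *)
Definition dist_at (r : ratfun) (f : R[i] -> R[i]) (z : R[i]) : \bar R :=
  if `[< regular_at r z >] then (cabs (reval r z - f z))%:E else +oo%E.

Definition unif_dist (r : ratfun) (f : R[i] -> R[i]) : \bar R :=
  ereal_sup [set dist_at r f (imag x) | x in `[-1, 1]].

Definition exp_error (omega : R) (r : ratfun) : \bar R :=
  unif_dist r (fun z => cexp (omega%:C * z)).

(* Least errors, as infima; a best approximant is an element of the class whose
   error equals this infimum, that is, a minimizer. *)
Definition cheb_error (n : nat) (omega : R) : \bar R :=
  ereal_inf [set exp_error omega r | r in ratfun_deg_le n].

Definition unitary_error (n : nat) (omega : R) : \bar R :=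
  ereal_inf [set exp_error omega r | r in unitary n].

Definition cheb_approximant (n : nat) (omega : R) (r : ratfun) : Prop :=
  ratfun_deg_le n r /\ exp_error omega r = cheb_error n omega.

Definition unitary_approximant (n : nat) (omega : R) (r : ratfun) : Prop :=
  unitary n r /\ exp_error omega r = unitary_error n omega.

End RationalFunctions.
Arguments ratfun R : clear implicits.

(* Main.v *)
Require Import Defs.
From mathcomp Require Import all_boot all_order all_algebra.
From mathcomp Require Import complex.
From mathcomp Require Import all_classical all_reals all_analysis.
From mathcomp Require Import ring lra zify.
Import Order.TTheory GRing.Theory Num.Theory.
Import numFieldNormedType.Exports.
Local Open Scope ring_scope.

(* On the imaginary axis a unitary function of degree at most n is s / conj s
   for a polynomial s in the real variable x. With
   twist s = s exp(- i w x / 2), its distance to exp(i w x) is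
   2 |Im twist s| / |twist s|, so small unitary errors correspond to nonzero
   points of the convex cone |Im twist s| <= tau Re twist s on [-1, 1].

   Lower bound: let tau be the least slope for which this cone is nontrivial,
   attained at s coprime to its conjugate, and suppose that p / q has error
   e < tau / sqrt (1 + tau ^ 2). The real polynomial
   F = |p conj s - q s| ^ 2 - e ^ 2 |q s| ^ 2 is positive where s touches the
   boundary of the cone and nonpositive where Im twist s = 0. Its degree bounds
   the number of sign changes of Im twist s along {F > 0}, so some real
   polynomial H of low degree has the sign of Im twist s there. By Bezout
   H = - Im (conj s T) with deg T <= n, and s + eps T lies in the interior of
   the cone, contradicting the minimality of tau.

   Strictness: a unitary r of error e is improved by (1 - e ^ 2 / 2) r, and the
   unitary errors stay away from 0 because no cone of slope 0 is nontrivial.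

   For w >= (n + 1) pi the exponential alternates on an equispaced grid with too
   many nodes for the polynomials Re (c p conj q) and Re (c s). *)

Set Implicit Arguments.
Unset Strict Implicit.
Unset Printing Implicit Defensive.

Local Notation re := (@complex.Re _).
Local Notation im := (@complex.Im _).

(** * Sign changes of real polynomials *)

Section RealLemmas.
Context {R : realType}.
Implicit Types (f g phi : R -> R) (F G H : {poly R}).

Lemma continuous_pos f x : continuous f -> 0 < f x ->
  exists2 d, 0 < d & forall y, `|y - x| < d -> 0 < f y.
Proof.
move=> cf fx; have : \forall y \near x, 0 < f y.
  by near=> y; near: y; apply: (cvgr_gt (f x)) => //; exact: cf.
move=> /nbhs_ballP[d /= d0 dP]; exists d => // y yx; apply: dP.
by rewrite /ball/= distrC.
Unshelve. all: by end_near. Qed.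

Lemma ivt_zero f a b : continuous f -> a <= b -> f a * f b <= 0 ->
  exists2 c, a <= c <= b & f c = 0.
Proof.
move=> cf ab fab.
have [||c] := @IVT R f a b 0 ab; first exact: continuous_subspaceT.
  by rewrite ge_min le_max; nra.
by rewrite in_itv/= => cab fc; exists c.
Qed.

(** By compactness max(f, g) has a minimum m > 0 on [a, b]. Where g <= 0 this gives f >= m, so a
    small enough multiple of g cannot destroy positivity; where g > 0 both terms help. *)
Lemma positive_perturbation f g (a b : R) : a <= b ->
  continuous f -> continuous g ->
  (forall x, a <= x <= b -> 0 <= f x) ->
  (forall x, a <= x <= b -> f x = 0 -> 0 < g x) ->
  exists2 e, 0 < e & forall x, a <= x <= b -> 0 < f x + e * g x.
Proof.
move=> ab cf cg f0 g0.
have [|c] := @EVT_min R (fun x => Num.max (f x) (g x)) a b ab.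
  by apply: continuous_subspaceT => x; exact: continuous_max (cf x) (cg x).
rewrite in_itv/= => cab cmin.
have [|d] := @EVT_min R g a b ab; first exact: continuous_subspaceT.
rewrite in_itv/= => dab dmin.
set m := Num.max (f c) (g c) in cmin.
have m0 : 0 < m.
  rewrite /m lt_max; have := f0 _ cab; rewrite le_eqVlt => /predU1P[/esym /g0|->//].
  by move=> /(_ cab) ->; rewrite orbT.
have M0 : 0 < `|g d| + 1 by rewrite ltr_wpDl.
exists (m / (`|g d| + 1) / 2) => [|x xab]; first by rewrite !divr_gt0.
have e0 : 0 < m / (`|g d| + 1) / 2 by rewrite !divr_gt0.
have [gx|gx] := ltP 0 (g x).
  by have := f0 _ xab; have := mulr_gt0 e0 gx; lra.
have fm : m <= f x.
  have := cmin x; rewrite in_itv/= xab => /(_ isT).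
  rewrite le_max => /orP[//|]; lra.
have gd : g d <= g x by apply: dmin; rewrite in_itv.
have : m / (`|g d| + 1) * (`|g d| + 1) = m by rewrite divfK// gt_eqF.
have := ler_norm (- g d); rewrite normrN.
move: e0; set t := m / _; nra.
Qed.

(** A translation preserves the degree and the leading coefficient, so the top terms cancel. *)
Lemma size_sub_shift F h : (size (F - (F \Po ('X + h%:P)))%R <= (size F).-1)%N.
Proof.
have s2 : size ('X + h%:P : {poly R}) = 2%N by rewrite size_XaddC.
have [->|F0] := eqVneq F 0; first by rewrite linear0 subr0 size_poly0.
apply/leq_sizeP => j; rewrite leq_eqVlt => /predU1P[<-|Fj].
  have : lead_coef (F \Po ('X + h%:P)) = lead_coef F.
    by rewrite lead_coef_comp ?s2// lead_coefXaddC expr1n mulr1.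
  by rewrite /lead_coef size_comp_poly2// coefB => ->; rewrite subrr.
have {}Fj : (size F <= j)%N by move: Fj; case: (size F).
by rewrite coefB !nth_default ?subrr// size_comp_poly2.
Qed.

(* Differencing keeps the alternation and lowers both the degree and the
   number of nodes by one. *)
Lemma alternating_zero N F (a h : R) : (size F <= N)%N ->
  (forall k, (k <= N)%N -> 0 <= (-1) ^+ k * F.[a + k%:R * h]) ->
  forall k, (k <= N)%N -> F.[a + k%:R * h] = 0.
Proof.
elim: N F => [|N IH] F sF alt k kN.
  by move: sF; rewrite leqn0 size_poly_eq0 => /eqP ->; rewrite horner0.
have hD j : (F - (F \Po ('X + h%:P))).[a + j%:R * h] =
    F.[a + j%:R * h] - F.[a + j.+1%:R * h].
  rewrite hornerD hornerN horner_comp !hornerE; congr (_ - F.[_]).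
  by rewrite -natr1; ring.
have sD : (size (F - (F \Po ('X + h%:P)))%R <= N)%N.
  by rewrite (leq_trans (size_sub_shift _ _))//; case: (size F) sF.
(* The difference polynomial vanishes at the node, so two consecutive values of [F] agree; their
   weak signs are opposite, hence both are 0. *)
have pos j : (j <= N)%N ->
    F.[a + j%:R * h] = 0 /\ F.[a + j.+1%:R * h] = 0.
  move=> jN; have := IH _ sD _ j jN; rewrite hD => D0.
  have {}D0 : F.[a + j%:R * h] = F.[a + j.+1%:R * h].
    apply/eqP; rewrite -subr_eq0; apply/eqP/D0 => i iN.
    have := alt i (leqW iN); have := alt i.+1 iN; rewrite hD exprS; lra.
  have := alt j (leqW jN); have := alt j.+1 jN; rewrite exprS -D0.
  move=> u v; have /eqP : (-1) ^+ j * F.[a + j%:R * h] = 0 by lra.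
  by rewrite mulf_eq0 signr_eq0/= => /eqP ->.
case: k kN => [|k] kN; first by have [] := pos 0%N.
by have [] := pos k kN.
Qed.

(** Divided by the full power of X - c, [F] leaves a cofactor that is nonzero at c and hence near c;
    its square expresses this as positivity. *)
Lemma root_gap F (c : R) : F != 0 ->
  exists2 d, 0 < d & forall x, c < x < c + d -> F.[x] != 0.
Proof.
move=> F0; have [m [G]] := multiplicity_XsubC F c; rewrite F0 /= => Gc ->.
have [||d d0 dP] := @continuous_pos (fun x => G.[x] ^+ 2) c.
- by move=> x; apply: cvgM; exact: continuous_horner.
- by rewrite lt_def sqr_ge0 andbT expf_eq0.
exists d => // x xc; rewrite hornerM mulf_neq0//.
  suff : 0 < G.[x] ^+ 2 by rewrite lt_def sqr_ge0 andbT expf_eq0.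
  by apply: dP; rewrite gtr0_norm; lra.
by rewrite horner_exp hornerXsubC expf_neq0// subr_eq0 gt_eqF//; lra.
Qed.

Lemma poly_gap_pos F (c a x : R) : 0 < F.[a] ->
  (forall y, c < y <= a -> F.[y] != 0) -> c < x <= a -> 0 < F.[x].
Proof.
move=> Fa Fn xca; rewrite lt_def Fn//= leNgt; apply/negP => Fx.
have [|||y yxa /eqP] := @ivt_zero (horner F) x a; [exact: continuous_horner|lra|nra|].
by apply/negP/Fn; lra.
Qed.

(* The infimum is a limit from the right of points with F > 0, so F has no
   root immediately to the right of it. *)
Lemma inf_pos_gap F (B : set R) : (B !=set0)%classic -> has_lbound B ->
  (forall x, B x -> 0 < F.[x]) -> ~ B (inf B) ->
  exists a, [/\ B a, inf B < a & forall y, inf B < y <= a -> F.[y] != 0].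
Proof.
move=> B0 lB BF nB.
have F0 : F != 0.
  have [x /BF] := B0; apply: contraTneq => ->; rewrite horner0 ltxx//.
have [d d0 dP] := root_gap (inf B) F0.
have [a Ba ad] := inf_adherent d0 (conj B0 lB).
have Ia : inf B < a.
  rewrite lt_def ge_inf// andbT; apply/eqP => aI; apply: nB; rewrite -aI//.
by exists a; split => // y ya; apply: dP; lra.
Qed.

Lemma same_sign F phi (c a b x : R) : continuous phi -> a <= b ->
  0 < F.[a] -> (forall y, c < y <= a -> F.[y] != 0) ->
  (forall y, c < y <= b -> 0 < F.[y] -> phi y != 0) ->
  c < x <= a -> 0 < phi x * phi a.
Proof.
move=> cphi ab Fa Fn Fphi xca; rewrite ltNge; apply/negP => le0.
have [||y yxa] := @ivt_zero phi x a cphi; [lra|by []|].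
have yca : c < y <= a by lra.
by apply/eqP/Fphi; [lra|exact: poly_gap_pos yca].
Qed.

(* With b0 the first point where phi < 0 < F, F has two roots in ]a, b0], one
   of them b0: remove them from F, put b0 - X into H, and go on from a point a'
   just to the right of b0. *)
Lemma sign_poly_from k F phi (a b : R) : continuous phi -> a <= b ->
  (size F <= k.*2.+1)%N -> 0 < F.[a] -> 0 < phi a ->
  (forall x, a <= x <= b -> 0 < F.[x] -> phi x != 0) ->
  exists H, [/\ (size H <= k.+1)%N, forall x, x <= a -> 0 < H.[x] &
    forall x, a <= x <= b -> 0 < F.[x] -> 0 < H.[x] * phi x].
Proof.
elim: k F phi a => [|k IH] F phi a cphi ab sF Fa phia Fphi.
  exists 1; split => [|x _|x xab Fx]; rewrite ?size_poly1 ?hornerE ?mul1r //.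
  rewrite lt_def Fphi//= leNgt; apply/negP => px.
  have [||y yax] := @ivt_zero phi a x cphi; [lra|nra|].
  apply/eqP/Fphi; first lra.
  by move: Fa; rewrite (size1_polyC sF) !hornerE.
set B := [set x | [/\ a <= x <= b, 0 < F.[x] & phi x < 0]]%classic.
have [B0|nB] := pselect (B !=set0)%classic; last first.
  exists 1; split => [|x _|x xab Fx]; rewrite ?size_poly1 ?hornerE ?mul1r //.
  rewrite lt_def Fphi//= leNgt; apply/negP => px.
  by apply: nB; exists x.
have lB : has_lbound B by exists a => x [/andP[]].
have aI : a <= inf B by apply: lb_le_inf => // x [/andP[]].
have Ib : inf B <= b.
  have [x Bx] := B0; apply: (le_trans (ge_inf lB Bx)); case: Bx; lra.
have cF G : continuous (horner G) by exact: continuous_horner.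
(* If F were positive at inf B, phi would be nonzero there. A positive value contradicts the points
   of B arbitrarily close to inf B; a negative one puts points to the left of inf B into B. *)
have FI0 : F.[inf B] <= 0.
  rewrite leNgt; apply/negP => FI.
  have pI : phi (inf B) != 0 by apply: Fphi => //; lra.
  have [pI0|pI0] := ltP 0 (phi (inf B)).
    have [d d0 dP] := continuous_pos cphi pI0.
    have [x Bx xd] := inf_adherent d0 (conj B0 lB).
    have Ix := ge_inf lB Bx; case: (Bx) => _ _ px.
    by have := dP x; rewrite ger0_norm; lra.
  have aI' : a < inf B.
    rewrite lt_neqAle aI andbT; apply/eqP => aeq; move: pI0; rewrite -aeq; lra.
  have cnphi : continuous (fun x => - phi x) by move=> x; apply: cvgN; exact: cphi.
  have pIn : 0 < - phi (inf B) by rewrite oppr_gt0 lt_neqAle pI.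
  have [d d0 dP] := continuous_pos cnphi pIn.
  have [d' d0' dP'] := continuous_pos (cF F) FI.
  pose t := Num.min (Num.min d d') (inf B - a).
  have t0 : 0 < t by rewrite !lt_min d0 d0' subr_gt0.
  have [t1 t2 t3] : [/\ t <= d, t <= d' & t <= inf B - a].
    by split; rewrite /t !ge_min lexx ?orbT.
  have nx : `|inf B - t / 2 - inf B| = t / 2.
    by rewrite addrAC subrr sub0r normrN gtr0_norm// divr_gt0.
  have : B (inf B - t / 2).
    split; [lra| |]; first by apply: dP'; rewrite nx; lra.
    by have := dP (inf B - t / 2); rewrite nx oppr_gt0; apply; lra.
  by move=> /(ge_inf lB); lra.
have FI : F.[inf B] = 0.
  apply/le_anti; rewrite FI0/= leNgt; apply/negP => FI.
  have FIn : 0 < (- F).[inf B] by rewrite hornerN oppr_gt0.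
  have [d d0 dP] := continuous_pos (cF _) FIn.
  have [x Bx xd] := inf_adherent d0 (conj B0 lB).
  have Ix := ge_inf lB Bx; case: (Bx) => _ Fx _.
  have : 0 < (- F).[x] by apply: dP; rewrite ger0_norm; lra.
  by rewrite hornerN; lra.
have nBI : ~ B (inf B) by move=> [_]; rewrite FI ltxx.
have [|a' [Ba' Ia' gap]] := @inf_pos_gap F B B0 lB _ nBI; first by move=> x [].
have [a'b Fa' pa'] := Ba'.
have [F0 F0E] : exists G, F = G * ('X - (inf B)%:P) by apply/factor_theorem; rewrite /root FI.
have aI' : a < inf B.
  by rewrite lt_def aI andbT; apply/eqP => E; move: FI Fa; rewrite E => ->; rewrite ltxx.
have F0a : F0.[a] < 0 by move: Fa; rewrite F0E !hornerE; nra.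
have F0a' : 0 < F0.[a'] by move: Fa'; rewrite F0E !hornerE; nra.
(* [F0] has opposite signs at a and a', which gives the second root. The gap to the right of inf B
   forces z1 <= inf B; equality is possible and means a double root of F. *)
have [|||z1 z1a F0z1] := @ivt_zero (horner F0) a a'; [exact: cF|lra|nra|].
have Fz1 : F.[z1] = 0 by rewrite F0E !hornerE/= F0z1 mul0r.
have z1I : z1 <= inf B.
  by rewrite leNgt; apply/negP => Iz1; have := gap z1; rewrite Fz1 eqxx Iz1; case/andP: z1a => _ -> /(_ isT).
have [F1 F1E] : exists G, F0 = G * ('X - z1%:P) by apply/factor_theorem; rewrite /root F0z1.
have F_n0 : F != 0 by apply: contraTneq Fa => ->; rewrite horner0 ltxx.
have F1n0 : F1 != 0.
  by apply: contra_neq F_n0; rewrite F0E F1E => ->; rewrite !mul0r.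
have sF1 : (size F1 <= k.*2.+1)%N.
  move: sF; rewrite F0E F1E !size_Mmonic ?monicXsubC ?mulf_neq0 ?polyXsubC_eq0//.
  by rewrite !size_XsubC !addn2 /= doubleS !ltnS.
have FF1 x : inf B < x -> (0 < F.[x]) = (0 < F1.[x]).
  move=> Ix; rewrite F0E F1E !hornerE pmulr_lgt0 ?pmulr_lgt0//; lra.
have cnphi : continuous (fun x => - phi x) by move=> x; apply: cvgN; exact: cphi.
have [||||H1 [sH1 H1l H1r]] := IH F1 (fun x => - phi x) a' cnphi _ sF1.
- lra.
- by rewrite -FF1.
- lra.
- by move=> x xab; rewrite -FF1; [move=> Fx; rewrite oppr_eq0; apply: Fphi => //; lra|lra].
(* The new factor is positive to the left of inf B, where F > 0 implies phi > 0, and negative to the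
   right, where [H1] follows the sign of - phi. *)
exists (((inf B)%:P - 'X) * H1); split.
- rewrite (leq_trans (size_polyMleq _ _))//.
  by rewrite -opprB size_polyN size_XsubC.
- by move=> x xa; rewrite !hornerE mulr_gt0 ?H1l//; lra.
move=> x xab Fx; rewrite !hornerE -mulrA.
have [xI|xI|xI] := ltgtP x (inf B).
- have H1x : 0 < H1.[x] by apply: H1l; lra.
  have px : 0 < phi x.
    rewrite lt_def Fphi//= leNgt; apply/negP => px.
    have /(ge_inf lB) : B x by split.
    lra.
  by rewrite !mulr_gt0 ?subr_gt0.
- have [xa'|xa'] := leP x a'.
    have H1x : 0 < H1.[x] by apply: H1l.
    have : 0 < phi x * phi a'.
      apply: (@same_sign F phi (inf B) a' b) => //; [lra| |lra].
      by move=> y yI; apply: Fphi; lra.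
    have := mulr_gt0 H1x (_ : 0 < x - inf B); rewrite subr_gt0 => /(_ xI).
    nra.
  have := H1r x; rewrite -FF1// => /(_ _ Fx); rewrite mulrN oppr_gt0 => u.
  have {}u : H1.[x] * phi x < 0 by apply: u; lra.
  nra.
- by move: Fx; rewrite xI FI ltxx.
Qed.

End RealLemmas.

Section RealLemmas.
Context {R : realType}.
Implicit Types (f g phi : R -> R) (F G H : {poly R}).

(** The starting point is so close to the infimum of {F > 0} that phi keeps its sign on this set up
    to there; replacing phi by - phi makes the sign positive. Degree 2 k of F costs only degree k of
    H, since each sign change uses up two roots of F. *)
Lemma sign_poly k F phi (a b : R) : continuous phi ->
  (size F <= k.*2.+1)%N ->
  (forall x, a <= x <= b -> 0 < F.[x] -> phi x != 0) ->
  exists2 H : {poly R}, (size H <= k.+1)%N &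
    forall x, a <= x <= b -> 0 < F.[x] -> 0 < H.[x] * phi x.
Proof.
move=> cphi sF Fphi; set B := [set x | a <= x <= b /\ 0 < F.[x]]%classic.
have [B0|nB] := pselect (B !=set0)%classic; last first.
  by exists 0 => [|x xab Fx]; rewrite ?size_poly0//; case: nB; exists x.
have lB : has_lbound B by exists a => x [/andP[]].
have aI : a <= inf B by apply: lb_le_inf => // x [/andP[]].
have [a' [[a'b Fa'] sgn]] : exists a', B a' /\
    forall x, a <= x <= a' -> 0 < F.[x] -> 0 < phi x * phi a'.
  have [BI|nBI] := pselect (B (inf B)).
    exists (inf B); split=> // x xI Fx; have xB : B x by split=> //; case: BI; lra.
    have -> : x = inf B by apply/le_anti; rewrite ge_inf// andbT; case/andP: xI.
    by have := Fphi _ BI.1 BI.2; rewrite -expr2 lt_def sqr_ge0 andbT expf_eq0.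
  have [|a' [Ba' Ia' gap]] := @inf_pos_gap R F B B0 lB _ nBI; first by move=> x [].
  exists a'; split=> // x xa' Fx; have [a'b Fa'] := Ba'.
  have Bx : B x by split=> //; lra.
  have Ix : inf B < x.
    rewrite lt_def ge_inf// andbT; apply/eqP => xI; apply: nBI; rewrite -xI//.
  apply: (@same_sign R F phi (inf B) a' b) => //; [lra| |lra].
  by move=> y yI; apply: Fphi; lra.
have pa' : phi a' != 0 by exact: Fphi.
wlog pa'0 : phi cphi Fphi sgn pa' / 0 < phi a'.
  move=> W; have [/W|pn] := ltP 0 (phi a'); first exact.
  have [|||||H sH HP] := W (fun x => - phi x).
  - by move=> x; apply: cvgN; exact: cphi.
  - by move=> x xab Fx; rewrite oppr_eq0 Fphi.
  - by move=> x xab Fx; rewrite mulrNN sgn.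
  - by rewrite oppr_eq0.
  - by rewrite oppr_gt0 lt_neqAle pa'.
  exists (- H) => [|x xab Fx]; first by rewrite size_polyN.
  by rewrite hornerN mulNr -mulrN HP.
have [||H [sH Hl Hr]] := @sign_poly_from R k F phi a' b cphi _ sF Fa' pa'0.
- lra.
- by move=> x xab; apply: Fphi; lra.
exists H => // x xab Fx; have [xa'|xa'] := leP x a'; last by apply: Hr => //; lra.
have := sgn x; rewrite xa' andbT => /(_ _ Fx); have := Hl _ xa'; case/andP: xab => ax _ Hx /(_ ax).
nra.
Qed.
End RealLemmas.

(** * The cone of a unitary function *)

Section ComplexPoly.
Local Open Scope complex_scope.
Context {R : realType}.
Implicit Types (s p q : {poly R[i]}) (z : R[i]) (x w : R).

Lemma reD (y z : R[i]) : re (y + z) = re y + re z.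
Proof. by case: y; case: z. Qed.
Lemma imD (y z : R[i]) : im (y + z) = im y + im z.
Proof. by case: y; case: z. Qed.
Lemma reZ (k : R) z : re (k%:C * z) = k * re z.
Proof. by case: z => a b /=; rewrite mul0r subr0. Qed.
Lemma imZ (k : R) z : im (k%:C * z) = k * im z.
Proof. by case: z => a b /=; rewrite mul0r addr0. Qed.

Definition re_poly s : {poly R} := \poly_(j < size s) re s`_j.
Definition im_poly s : {poly R} := \poly_(j < size s) im s`_j.

Lemma re_sum I (r : seq I) (f : I -> R[i]) :
  re (\sum_(i <- r) f i) = \sum_(i <- r) re (f i).
Proof. by apply: (big_morph re) => //; exact: reD. Qed.

Lemma im_sum I (r : seq I) (f : I -> R[i]) :
  im (\sum_(i <- r) f i) = \sum_(i <- r) im (f i).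
Proof. by apply: (big_morph im) => //; exact: imD. Qed.

Lemma horner_real s x : s.[x%:C] = (re_poly s).[x] +i* (im_poly s).[x].
Proof.
rewrite horner_coef !horner_poly; apply/eqP; rewrite eq_complex /=.
by rewrite re_sum im_sum; apply/andP; split; apply/eqP/eq_bigr => j _;
  rewrite -rmorphXn mulrC ?reZ ?imZ mulrC.
Qed.

Lemma re_horner s x : (re_poly s).[x] = re s.[x%:C].
Proof. by rewrite horner_real. Qed.

Lemma size_re_poly s : (size (re_poly s) <= size s)%N.
Proof. exact: size_poly. Qed.

Definition conjp s : {poly R[i]} := map_poly conjc s.

Lemma horner_conjp s x : (conjp s).[x%:C] = (s.[x%:C])^*%C.
Proof. by rewrite /conjp -{1}(conjc_real x) horner_map. Qed.

Lemma size_conjp s : size (conjp s) = size s.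
Proof. by rewrite /conjp size_map_poly. Qed.

Lemma poly_eq0_itv s (a b : R) : a < b ->
  (forall x, a <= x <= b -> s.[x%:C] = 0) -> s = 0.
Proof.
move=> ab s0; apply/eqP; apply: contraT => sn0.
(* Distinct points of the interval; the first [size s] of them already exceed the possible number of
   roots. *)
pose y (k : nat) : R := a + (b - a) / k.+1%:R.
have yi : injective y.
  move=> k l /addrI /mulfI; rewrite subr_eq0 gt_eqF// => /(_ isT) /invr_inj /eqP.
  by rewrite eqr_nat eqSS => /eqP.
have := @max_poly_roots _ s [seq (y k)%:C | k <- iota 0 (size s)] sn0.
rewrite size_map size_iota ltnn => -> //.
  apply/allP => _ /mapP[k _ ->]; apply/eqP/s0.
  have k0 : (0 : R) < k.+1%:R by rewrite ltr0n.
  have : (b - a) / k.+1%:R <= b - a.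
    by rewrite ler_pdivrMr// ler_peMr// ?subr_ge0 ?(ltW ab)// ler1n.
  have : 0 <= (b - a) / k.+1%:R by rewrite divr_ge0 ?subr_ge0 ?(ltW ab).
  by rewrite /y; set t := _ / _ => h1 h2; apply/andP; split; lra.
by rewrite map_inj_uniq ?iota_uniq// => k l /complexI /yi.
Qed.

Definition twist w s x : R[i] :=
  s.[x%:C] * (cos (w * x / 2) -i* sin (w * x / 2)).

Lemma re_twist w s x : re (twist w s x) =
  (re_poly s).[x] * cos (w * x / 2) + (im_poly s).[x] * sin (w * x / 2).
Proof. by rewrite /twist horner_real /=; ring. Qed.

Lemma im_twist w s x : im (twist w s x) =
  (im_poly s).[x] * cos (w * x / 2) - (re_poly s).[x] * sin (w * x / 2).
Proof. by rewrite /twist horner_real /=; ring. Qed.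

Lemma continuous_half w (f : R -> R) : continuous f ->
  continuous (fun x => f (w * x / 2)).
Proof.
move=> cf x; apply: (@continuous_comp _ _ _ (fun x => w * x / 2) f); last exact: cf.
by apply: cvgM; [apply: cvgM; [exact: cvg_cst|exact: cvg_id]|exact: cvg_cst].
Qed.

Lemma continuous_re_twist w s : continuous (fun x => re (twist w s x)).
Proof.
have -> : (fun x => re (twist w s x)) = (fun x =>
  (re_poly s).[x] * cos (w * x / 2) + (im_poly s).[x] * sin (w * x / 2)).
  by apply/funext => x; rewrite re_twist.
move=> x; apply: cvgD; apply: cvgM; try exact: continuous_horner.
- by apply: continuous_half; exact: continuous_cos.
- by apply: continuous_half; exact: continuous_sin.
Qed.

Lemma continuous_im_twist w s : continuous (fun x => im (twist w s x)).
Proof.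
have -> : (fun x => im (twist w s x)) = (fun x =>
  (im_poly s).[x] * cos (w * x / 2) - (re_poly s).[x] * sin (w * x / 2)).
  by apply/funext => x; rewrite im_twist.
move=> x; apply: cvgB; apply: cvgM; try exact: continuous_horner.
- by apply: continuous_half; exact: continuous_cos.
- by apply: continuous_half; exact: continuous_sin.
Qed.

(** For [tau] > 0 the values of the twist lie in the sector around the positive real axis with
    half-angle arctan tau. *)
Definition cone w (tau : R) s := forall x, -1 <= x <= 1 ->
  `|im (twist w s x)| <= tau * re (twist w s x).

Lemma cone_scale w tau s k : 0 <= k -> cone w tau s -> cone w tau (k%:C *: s).
Proof.
move=> k0 cs x xI; rewrite /twist hornerZ -mulrA reZ imZ normrM ger0_norm//.
by rewrite mulrCA ler_wpM2l// cs.
Qed.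

Lemma closed_continuous_le (T : topologicalType) (f g : T -> R) :
  continuous f -> continuous g -> closed [set v | f v <= g v]%classic.
Proof.
move=> cf cg; have -> : [set v | f v <= g v]%classic = ((f \- g) @^-1` [set x | x <= 0])%classic.
  by apply/seteqP; split=> v /=; rewrite subr_le0.
have : continuous (f \- g) by move=> v; apply: continuousB; [exact: cf|exact: cg].
by move=> /continuous_closedP/(_ _ (@closed_le R 0)).
Qed.

Lemma continuous_mul (T : topologicalType) (f g : T -> R) :
  continuous f -> continuous g -> continuous (fun v => f v * g v).
Proof. by move=> cf cg v; apply: continuousM; [exact: cf|exact: cg]. Qed.

Lemma continuous_add (T : topologicalType) (f g : T -> R) :
  continuous f -> continuous g -> continuous (fun v => f v + g v).
Proof. by move=> cf cg v; apply: continuousD; [exact: cf|exact: cg]. Qed.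

Lemma continuous_opp (T : topologicalType) (f : T -> R) :
  continuous f -> continuous (fun v => - f v).
Proof. by move=> cf v; apply: continuousN; exact: cf. Qed.

Lemma continuous_sumr (T : topologicalType) n (f : 'I_n -> T -> R) :
  (forall i, continuous (f i)) -> continuous (fun v => \sum_(i < n) f i v).
Proof.
elim: n f => [|n IH] f cf.
  have -> : (fun v => \sum_(i < 0) f i v) = cst 0 by apply/funext => v; rewrite big_ord0.
  exact: cst_continuous.
have -> : (fun v => \sum_(i < n.+1) f i v) =
    (fun v => \sum_(i < n) f (widen_ord (leqnSn n) i) v) \+ f ord_max.
  by apply/funext => v; rewrite big_ord_recr.
move=> v; apply: continuousD; last exact: cf.
exact: (IH (fun i => f (widen_ord (leqnSn n) i)) (fun i => cf _) v).
Qed.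

(** * Compactness of normalized pairs of a slope and a polynomial *)

Section Vectors.
Variable N : nat.
Local Notation V := 'rV[R]_(1 + (N + N)).
Implicit Types v : V.

(** A real vector of length 1 + 2 N encodes a slope together with the real and imaginary parts of N
    coefficients, so that finite-dimensional compactness applies to both at once. *)
Definition vtau v : R := v 0 (lshift (N + N) 0).
Definition va v (j : 'I_N) : R := v 0 (rshift 1 (lshift N j)).
Definition vb v (j : 'I_N) : R := v 0 (rshift 1 (rshift N j)).
Definition vpoly v : {poly R[i]} := \sum_(j < N) (va v j +i* vb v j) *: 'X^j.

Lemma coef_vpoly v (j : 'I_N) : (vpoly v)`_j = va v j +i* vb v j.
Proof.
rewrite coef_sum (bigD1 j)//= coefZ coefXn eqxx mulr1 big1 ?addr0// => i ij.
by rewrite coefZ coefXn (negPf (_ : _ != _)) ?mulr0// eq_sym.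
Qed.

Lemma size_vpoly v : (size (vpoly v) <= N)%N.
Proof.
apply: (leq_trans (size_sum _ _ _)); apply/bigmax_leqP => j _.
by rewrite (leq_trans (size_scale_leq _ _))// size_polyXn.
Qed.

Lemma vpoly_surj tau s : (size s <= N)%N ->
  exists2 v, vtau v = tau & vpoly v = s.
Proof.
move=> sN; exists (row_mx (tau%:M) (row_mx (\row_(j < N) re s`_j) (\row_(j < N) im s`_j)) : V).
  by rewrite /vtau row_mxEl mxE.
apply/polyP => j; have [jN|Nj] := ltnP j N; last first.
  by rewrite !nth_default// ?(leq_trans _ Nj)// size_vpoly.
rewrite (coef_vpoly _ (Ordinal jN)) /va /vb !row_mxEr row_mxEl !mxE /=.
by case: s`_j.
Qed.

Lemma continuous_vtwist w x :
  continuous (fun v => re (twist w (vpoly v) x)) /\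
  continuous (fun v => im (twist w (vpoly v) x)).
Proof.
have cvab (c d : R) j : continuous (fun v => va v j * c + vb v j * d).
  by apply: continuous_add; apply: continuous_mul; try exact: cst_continuous;
    exact: coord_continuous.
have E v : twist w (vpoly v) x = \sum_(j < N) (va v j +i* vb v j) *
    (x%:C ^+ j * (cos (w * x / 2) -i* sin (w * x / 2))).
  rewrite /twist horner_sum mulr_suml; apply: eq_bigr => j _.
  by rewrite hornerZ hornerXn mulrA.
set c := fun j : 'I_N => (x%:C ^+ j * (cos (w * x / 2) -i* sin (w * x / 2))).
split.
- have -> : (fun v => re (twist w (vpoly v) x)) = (fun v => \sum_(j < N)
      (va v j * re (c j) + vb v j * - im (c j))).
    apply/funext => v; rewrite E re_sum; apply: eq_bigr => j _.
    by rewrite -/(c j); case: (c j) => a b /=; ring.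
  by apply: continuous_sumr => j; exact: cvab.
- have -> : (fun v => im (twist w (vpoly v) x)) = (fun v => \sum_(j < N)
      (va v j * im (c j) + vb v j * re (c j))).
    apply/funext => v; rewrite E im_sum; apply: eq_bigr => j _.
    by rewrite -/(c j); case: (c j) => a b /=; ring.
  by apply: continuous_sumr => j; exact: cvab.
Qed.

Definition vnorm2 v : R := \sum_(j < N) (va v j ^+ 2 + vb v j ^+ 2).

Lemma continuous_vnorm2 : continuous vnorm2.
Proof.
apply: continuous_sumr => j.
by apply: continuous_add; apply: continuous_mul; exact: coord_continuous.
Qed.

Lemma vnorm2_gt0 v : vpoly v != 0 -> 0 < vnorm2 v.
Proof.
move=> v0; rewrite lt_def sumr_ge0 ?andbT//; last first.
  by move=> j _; rewrite addr_ge0 ?sqr_ge0.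
apply: contra_neq v0 => /eqP; rewrite psumr_eq0; last first.
  by move=> j _; rewrite addr_ge0 ?sqr_ge0.
move=> /allP v0; rewrite /vpoly big1// => j _.
have := v0 j; rewrite mem_index_enum => /(_ isT).
rewrite paddr_eq0 ?sqr_ge0// !sqrf_eq0 => /andP[/eqP -> /eqP ->].
by rewrite scale0r.
Qed.

(** The normalization of the coefficients keeps limits away from the zero polynomial, and [t0] keeps
    the slope bounded. *)
Definition feasible w t0 : set V := [set v | [/\ 0 <= vtau v <= t0,
  vnorm2 v = 1 & cone w (vtau v) (vpoly v)]]%classic.

Lemma compact_feasible w t0 : 0 <= t0 -> compact (feasible w t0).
Proof.
move=> t00.
pose K := [set v : V | forall i, `[- (t0 + 1), t0 + 1]%classic (v ord0 i)]%classic.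
have cK : compact K.
  by apply: (@rV_compact R _ (fun=> `[- (t0 + 1), t0 + 1]%classic)) => _; exact: segment_compact.
apply: (subclosed_compact _ cK) => [|v [/andP[tau0 taut] nv _] i].
  have [ctau cnorm] : continuous vtau /\ continuous vnorm2.
    by split; [exact: coord_continuous|exact: continuous_vnorm2].
  have ccst (c : R) : continuous (fun _ : V => c) by exact: cst_continuous.
  (* For fixed x each condition is a closed inequality. The index runs over all reals, and the
     restriction to [-1, 1] moves into the sets. *)
  have -> : feasible w t0 = (\bigcap_(x in [set: R]) ([set v | 0 <= vtau v] `&`
    [set v | vtau v <= t0] `&` [set v | vnorm2 v <= 1] `&`
    [set v | 1 <= vnorm2 v] `&`
    [set v | -1 <= x <= 1 -> im (twist w (vpoly v) x) <= vtau v * re (twist w (vpoly v) x)] `&`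
    [set v | -1 <= x <= 1 -> - im (twist w (vpoly v) x) <= vtau v * re (twist w (vpoly v) x)]))%classic.
    apply/seteqP; split=> v.
      move=> [/andP[v0 vt] nv cv] x _; repeat split => //=; rewrite ?nv//.
      - by move=> /cv; rewrite ler_norml; lra.
      - by move=> /cv; rewrite ler_norml; lra.
    move=> vP; have := vP 0 I => -[[[[[/= h1 h2] h3] h4] _] _].
    split; [by rewrite h1|by apply/le_anti; rewrite h3|move=> x xI].
    have [[_ /= /(_ xI) h5] /= /(_ xI) h6] := vP x I.
    by rewrite ler_norml h5 andbT lerNl.
  apply: closed_bigI => x _.
  have [cre cim] := continuous_vtwist w x.
  have imp (f g : V -> R) : continuous f -> continuous g ->
      closed [set v | -1 <= x <= 1 -> f v <= g v]%classic.
    move=> cf cg; case: (-1 <= x <= 1).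
      have -> : [set v | true -> f v <= g v]%classic = [set v | f v <= g v]%classic.
        by apply/seteqP; split=> v /=; [apply|].
      exact: closed_continuous_le.
    have -> : [set v | false -> f v <= g v]%classic = setT by apply/seteqP; split.
    exact: closedT.
  do ?apply: closedI; try exact: closed_continuous_le.
  - by apply: imp => //; exact: continuous_mul.
  - by apply: imp; [exact: continuous_opp|exact: continuous_mul].
rewrite /= in_itv/=.
have ab j : -1 <= va v j <= 1 /\ -1 <= vb v j <= 1.
  have : va v j ^+ 2 + vb v j ^+ 2 <= 1.
    rewrite -nv /vnorm2 (bigD1 j)//= lerDl sumr_ge0// => k _.
    by rewrite addr_ge0 ?sqr_ge0.
  by move=> h; split; nra.
case: (split_ordP i) => k ->.
  by rewrite (ord1 k) -/(vtau v); lra.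
case: (split_ordP k) => j ->.
  by have [] := ab j; rewrite /va; lra.
by have [] := ab j; rewrite /vb; lra.
Qed.

End Vectors.

(* Minimizing tau over a compact set of pairs (tau, s) with normalized s shows
   that the infimum of the slopes is attained. *)
Lemma cone_optimum N w (t0 : R) s0 : 0 <= t0 -> s0 != 0 -> (size s0 <= N)%N ->
  cone w t0 s0 ->
  exists (tau : R) s, [/\ 0 <= tau, s != 0, (size s <= N)%N, cone w tau s &
    forall t (r : {poly R[i]}), 0 <= t -> r != 0 -> (size r <= N)%N -> cone w t r -> tau <= t].
Proof.
move=> t00 s00 ss0 cs0.
have feas t (r : {poly R[i]}) : 0 <= t <= t0 -> r != 0 -> (size r <= N)%N -> cone w t r ->
    exists2 v, feasible (N := N) w t0 v & vtau v = t.
  move=> tt r0 rN cr.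
  have [v vt vr] := vpoly_surj t rN.
  have n0 : 0 < vnorm2 v by rewrite vnorm2_gt0// vr.
  have k0 : 0 <= (Num.sqrt (vnorm2 v))^-1 by rewrite invr_ge0 sqrtr_ge0.
  (* Division by the Euclidean norm of the coefficients, under which the cone is invariant. *)
  have [u ut ur] := @vpoly_surj N t (((Num.sqrt (vnorm2 v))^-1)%:C *: r)
    (leq_trans (size_scale_leq _ _) rN).
  exists u => //; split; rewrite ?ut//; last first.
    by rewrite ur; exact: cone_scale.
  have E j : va u j +i* vb u j =
      ((Num.sqrt (vnorm2 v))^-1)%:C * (va v j +i* vb v j).
    by rewrite -!coef_vpoly ur vr coefZ.
  rewrite /vnorm2 (eq_bigr (fun j => (vnorm2 v)^-1 *
      (va v j ^+ 2 + vb v j ^+ 2))) => [|j _].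
    by rewrite -mulr_sumr mulVf// gt_eqF.
  rewrite -[va u j]/(re (va u j +i* vb u j)) -[vb u j]/(im (va u j +i* vb u j)).
  rewrite E reZ imZ /=.
  by rewrite !exprMn exprVn sqr_sqrtr ?(ltW n0)// mulrDr.
have [|||c] := @EVT_min_rV R _ (@vtau N) (feasible w t0).
- by have [|v fv _] := @feas t0 s0 _ s00 ss0 cs0; [rewrite t00/= lexx|exists v].
- exact: compact_feasible.
- by apply: continuous_subspaceT; exact: coord_continuous.
rewrite inE => -[/andP[c0 ct] nc cc] cmin.
exists (vtau c), (vpoly c); split=> //; last 1 first.
- move=> t r tge r0 rN cr; have [tt0|/ltW t0t] := leP t t0; last exact: le_trans t0t.
  have [|v fv <-] := feas t r _ r0 rN cr; first by rewrite tge.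
  by apply: cmin; rewrite inE.
- apply: contra_eq_neq nc => vc0; rewrite /vnorm2 big1 ?(eq_sym 0) ?oner_eq0// => j _.
  have := coef_vpoly c j; rewrite vc0 coef0 => -[<- <-].
  by rewrite expr0n addr0.
- exact: size_vpoly.
Qed.

End ComplexPoly.

(** * Decreasing the slope of the cone *)

Section Improvement.
Context {R : realType}.
Local Open Scope complex_scope.
Implicit Types (s p q T : {poly R[i]}) (z : R[i]) (x w tau e : R).

Lemma sqr_cabs z : cabs z ^+ 2 = re z ^+ 2 + im z ^+ 2.
Proof. by case: z => a b /=; rewrite sqr_sqrtr// addr_ge0 ?sqr_ge0. Qed.

Lemma cabs_ge0 z : 0 <= cabs z.
Proof. by case: z => a b /=; exact: sqrtr_ge0. Qed.

Lemma cabsM y z : cabs (y * z) = cabs y * cabs z.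
Proof. exact: ComplexField.Normc.normcM. Qed.

Lemma cabs_eq0 z : (cabs z == 0) = (z == 0).
Proof.
apply/eqP/eqP => [|->]; last exact: ComplexField.Normc.normc0.
exact: ComplexField.Normc.eq0_normc.
Qed.

Lemma cabs_conj z : cabs z^*%C = cabs z.
Proof. by case: z => a b /=; rewrite sqrrN. Qed.

Lemma cabs_half w x : cabs (cos (w * x / 2) -i* sin (w * x / 2)) = 1.
Proof. by rewrite /= sqrrN cos2Dsin2 sqrtr1. Qed.

Lemma twist_add w s T k x : twist w (s + k%:C *: T) x = twist w s x + k%:C * twist w T x.
Proof. by rewrite /twist hornerD hornerZ mulrDl mulrA. Qed.

Lemma cabs_twist w s x : cabs (twist w s x) = cabs s.[x%:C].
Proof. by rewrite /twist cabsM cabs_half mulr1. Qed.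

Lemma twist_eq0 w s x : (twist w s x == 0) = (s.[x%:C] == 0).
Proof. by rewrite -cabs_eq0 cabs_twist cabs_eq0. Qed.

Lemma closed_pos (f : R -> R) x : continuous f ->
  (forall d, 0 < d -> exists2 y, `|y - x| < d & 0 <= f y) -> 0 <= f x.
Proof.
move=> cf acc; rewrite leNgt; apply/negP => fx.
have [|d d0 dP] := @continuous_pos _ (fun x => - f x) x (continuous_opp cf).
  by rewrite oppr_gt0.
by have [y /dP] := acc d d0; rewrite oppr_gt0; lra.
Qed.

Lemma nearby_point x d : -1 <= x <= 1 -> 0 < d ->
  exists y, [/\ -1 <= y <= 1, y != x & `|y - x| < d].
Proof.
move=> xI d0; pose t := Num.min d 1 / 2.
have [t0 td t1] : [/\ 0 < t, t < d & t <= 1 / 2].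
  have : Num.min d 1 <= d by rewrite ge_min lexx.
  have : Num.min d 1 <= 1 by rewrite ge_min lexx orbT.
  have : 0 < Num.min d 1 by rewrite lt_min d0 ltr01.
  by rewrite /t => *; split; lra.
have [x0|x0] := leP x 0.
  exists (x + t); split; [lra|by apply/eqP; lra|].
  by rewrite addrAC subrr add0r gtr0_norm.
exists (x - t); split; [lra|by apply/eqP; lra|].
by rewrite addrAC subrr add0r normrN gtr0_norm.
Qed.

(** Positive real factors do not affect the cone condition, and the exceptional point is recovered
    by continuity of the twist. *)
Lemma cone_div w tau s s' x0 :
  (forall x, -1 <= x <= 1 -> x != x0 ->
     exists2 k, 0 < k & twist w s x = k%:C * twist w s' x) ->
  cone w tau s -> cone w tau s'.
Proof.
move=> ss' cs.
have P x : -1 <= x <= 1 -> x != x0 -> `|im (twist w s' x)| <= tau * re (twist w s' x).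
  move=> xI xx0; have [k k0 E] := ss' x xI xx0; have := cs x xI.
  by rewrite E reZ imZ normrM gtr0_norm// mulrCA ler_pM2l.
move=> x xI; have [xx0|] := eqVneq x x0; last exact: P.
have cre := continuous_mul (@cst_continuous _ _ tau) (@continuous_re_twist R w s').
have cim := @continuous_im_twist R w s'.
have A d : 0 < d -> exists2 y, `|y - x| < d &
    `|im (twist w s' y)| <= tau * re (twist w s' y).
  move=> d0; have [y [yI yx yd]] := nearby_point xI d0.
  by exists y => //; apply: P; rewrite -?xx0.
have h1 : 0 <= tau * re (twist w s' x) - im (twist w s' x).
  apply: (closed_pos (continuous_add cre (continuous_opp cim))) => d /A[y yd].
  by rewrite ler_norml => h; exists y => //; lra.
have h2 : 0 <= tau * re (twist w s' x) - - im (twist w s' x).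
  apply: (closed_pos (continuous_add cre (continuous_opp (continuous_opp cim)))) => d /A[y yd].
  by rewrite ler_norml => h; exists y => //; lra.
by rewrite ler_norml; lra.
Qed.

(** A common root z of s and its conjugate has conj z as a root of s as well. A nonreal pair is
    removed through the positive factor |x - z| ^ 2. A real root outside ]-1, 1[ gives a factor of
    constant sign on [-1, 1], and a real root inside is at least double, so its square can be
    removed. *)
Lemma cone_step w tau s : 0 < tau -> s != 0 -> cone w tau s ->
  ~~ coprimep s (conjp s) ->
  exists s', [/\ s' != 0, (size s' < size s)%N & cone w tau s'].
Proof.
move=> tau0 s0 cs ncop.
have /closed_rootP[z] : size (gcdp s (conjp s)) != 1%N.
  by move: ncop; rewrite coprimep_def.
rewrite root_gcd => /andP[sz scz].
have s_lt s1 y : s = s1 * ('X - y%:P) -> s1 != 0 /\ (size s1 < size s)%N.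
  move=> E; have s10 : s1 != 0 by apply: contra_neq s0; rewrite E => ->; rewrite mul0r.
  by rewrite E size_Mmonic ?monicXsubC// size_XsubC addn2.
have [s1 E1] := factor_theorem _ _ sz.
have [s10 s1s] := s_lt _ _ E1.
have [zr|zi] := eqVneq (im z) 0; last first.
  have sz' : root s z^*%C.
    move: scz; rewrite /root; rewrite -[z in (_).[z]]conjcK /conjp horner_map.
    by rewrite conjc_eq0.
  have : root s1 z^*%C.
    move: sz'; rewrite E1 rootM root_XsubC => /orP[//|/eqP].
    by move: zi; case: (z) => a b /= /eqP b0 [] h; exfalso; apply: b0; lra.
  case/factor_theorem => s2 E2.
  have [s20 s21] : s2 != 0 /\ (size s2 < size s1)%N.
    have s20 : s2 != 0 by apply: contra_neq s10; rewrite E2 => ->; rewrite mul0r.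
    by rewrite E2 size_Mmonic ?monicXsubC// size_XsubC addn2.
  exists s2; split=> //; first exact: ltn_trans s1s.
  (* The exceptional point 2 lies outside [-1, 1], so nothing is excluded. *)
  apply: (@cone_div w tau s s2 2 _ cs) => x _ _.
  exists ((x - re z) ^+ 2 + im z ^+ 2).
    by rewrite ltr_wpDl ?sqr_ge0// lt_def sqr_ge0 sqrf_eq0 zi.
  have -> : ((x - re z) ^+ 2 + im z ^+ 2)%:C = (x%:C - z) * (x%:C - z^*%C).
    by case: (z) => a b; apply/eqP; rewrite eq_complex /=; apply/andP; split; apply/eqP; ring.
  by rewrite /twist E1 E2 !hornerM !hornerXsubC; ring.
have {zr}zE : z = (re z)%:C by move: zr; case: (z) => a b /= ->.
set x0 := re z in zE.
have SE x : twist w s x = (x - x0)%:C * twist w s1 x.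
  by rewrite /twist E1 hornerM hornerXsubC zE rmorphB /=; ring.
have SN x : twist w (- s1) x = - twist w s1 x by rewrite /twist hornerN mulNr.
have [x01|x01] := leP 1 x0.
  exists (- s1); rewrite oppr_eq0 size_polyN; split=> //.
  apply: (@cone_div w tau s _ x0 _ cs) => x xI xx0.
  have lt : x < x0 by rewrite lt_neqAle xx0/=; lra.
  by exists (x0 - x); [lra|rewrite SN SE -[x - x0]opprB rmorphN mulNr mulrN].
have [x02|x02] := leP x0 (-1).
  exists s1; split=> //; apply: (@cone_div w tau s _ x0 _ cs) => x xI xx0.
  have lt : x0 < x by rewrite lt_neqAle eq_sym xx0/=; lra.
  by exists (x - x0); [lra|rewrite SE].
have cre := continuous_mul (@cst_continuous _ _ tau) (@continuous_re_twist R w s1).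
have cim := @continuous_im_twist R w s1.
(* The twist of s1 lies in the cone on the right of x0 and in its opposite on
   the left, hence vanishes at x0. *)
have side d : 0 < d -> exists2 t, 0 < t < d & (-1 <= x0 + t <= 1) && (-1 <= x0 - t <= 1).
  move=> d0; pose m := Num.min d (Num.min (1 - x0) (x0 + 1)).
  have m0 : 0 < m by rewrite !lt_min d0/=; lra.
  have [m1 m2 m3] : [/\ m <= d, m <= 1 - x0 & m <= x0 + 1].
    by split; rewrite /m !ge_min lexx ?orbT.
  by exists (m / 2); [lra|apply/andP; split; lra].
have right d : 0 < d -> exists2 y, `|y - x0| < d & `|im (twist w s1 y)| <= tau * re (twist w s1 y).
  move=> d0; have [t /andP[t0 td] /andP[t1 _]] := side d d0.
  exists (x0 + t); first by rewrite addrAC subrr add0r gtr0_norm.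
  have := cs _ t1; rewrite SE reZ imZ addrAC subrr add0r normrM (gtr0_norm t0).
  by rewrite mulrCA ler_pM2l.
have left d : 0 < d -> exists2 y, `|y - x0| < d & `|im (twist w s1 y)| <= - (tau * re (twist w s1 y)).
  move=> d0; have [t /andP[t0 td] /andP[_ t1]] := side d d0.
  exists (x0 - t); first by rewrite addrAC subrr add0r normrN gtr0_norm.
  have := cs _ t1; rewrite SE reZ imZ addrAC subrr add0r normrM normrN (gtr0_norm t0).
  set r := re _; have -> : tau * (- t * r) = t * - (tau * r) by ring.
  by rewrite ler_pM2l.
have S1 : twist w s1 x0 = 0.
  have h1 : 0 <= tau * re (twist w s1 x0) - im (twist w s1 x0).
    apply: (closed_pos (continuous_add cre (continuous_opp cim))) => d /right[y yd].
    by rewrite ler_norml => h; exists y => //; lra.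
  have h2 : 0 <= tau * re (twist w s1 x0) - - im (twist w s1 x0).
    apply: (closed_pos (continuous_add cre (continuous_opp (continuous_opp cim)))) => d /right[y yd].
    by rewrite ler_norml => h; exists y => //; lra.
  have h3 : 0 <= - (tau * re (twist w s1 x0)) - im (twist w s1 x0).
    apply: (closed_pos (continuous_add (continuous_opp cre) (continuous_opp cim))) => d /left[y yd].
    by rewrite ler_norml => h; exists y => //; lra.
  have h4 : 0 <= - (tau * re (twist w s1 x0)) - - im (twist w s1 x0).
    apply: (closed_pos (continuous_add (continuous_opp cre)
      (continuous_opp (continuous_opp cim)))) => d /left[y yd].
    by rewrite ler_norml => h; exists y => //; lra.
  have im0 : im (twist w s1 x0) = 0 by lra.
  have : tau * re (twist w s1 x0) = 0 by lra.
  move=> /eqP; rewrite mulf_eq0 gt_eqF//= => /eqP.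
  by move: im0; case: (twist w s1 x0) => a b /= -> ->.
have : root s1 x0%:C by rewrite /root -(twist_eq0 w) S1.
case/factor_theorem => s2 E2.
have s20 : s2 != 0 by apply: contra_neq s10; rewrite E2 => ->; rewrite mul0r.
have s21 : (size s2 < size s1)%N.
  by rewrite E2 size_Mmonic ?monicXsubC// size_XsubC addn2.
exists s2; split=> //; first exact: ltn_trans s1s.
apply: (@cone_div w tau s s2 x0 _ cs) => x _ xx0.
exists ((x - x0) ^+ 2); first by rewrite lt_def sqr_ge0 sqrf_eq0 subr_eq0 xx0.
by rewrite SE /twist E2 hornerM hornerXsubC rmorphXn rmorphB /=; ring.
Qed.

Lemma cone_reduced w tau s : 0 < tau -> s != 0 -> cone w tau s ->
  exists s', [/\ s' != 0, (size s' <= size s)%N, cone w tau s' &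
    coprimep s' (conjp s')].
Proof.
move=> tau0; have [m] := ubnP (size s); elim: m s => // m IH s sm s0 cs.
have [cop|ncop] := boolP (coprimep s (conjp s)); first by exists s.
have [s' [s'0 s's cs']] := cone_step tau0 s0 cs ncop.
have [|s'' [? ? ? ?]] := IH s' _ s'0 cs'; first exact: leq_trans s's _.
by exists s''; split=> //; apply: leq_trans (ltnW s's).
Qed.
End Improvement.

(** * Moving a polynomial into the interior of its cone *)

Section Improvement2.
Context {R : realType}.
Local Open Scope complex_scope.
Implicit Types (s p q T : {poly R[i]}) (z : R[i]) (x w tau e : R).

(** Bezout solves conj s * u + s * v = - 2 i H. On the real line T = (u - conj v) / 2 then satisfies
    Im (conj s T) = Im (conj s u + s v) / 2 = - H. Reducing u modulo s bounds its size, and the size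
    of H bounds that of v. *)
Lemma bezout_im N s (H : {poly R}) : s != 0 -> (size s <= N)%N ->
  coprimep s (conjp s) -> (size H <= (N + size s).-1)%N ->
  exists2 T : {poly R[i]}, (size T <= N)%N &
    forall x, im ((s.[x%:C])^*%C * T.[x%:C]) = - H.[x].
Proof.
move=> s0 sN cop sH.
have ss0 : (0 < size s)%N by rewrite lt0n size_poly_eq0.
have [[u0 v0] /= uv] := Bezout_eq1_coprimepP _ _ cop.
pose h : {poly R[i]} := (0 -i* 2) *: map_poly (real_complex R) H.
pose u : {poly R[i]} := (h * v0) %% s.
have : s %| h - conjp s * u.
  have -> : h - conjp s * u = s * (h * u0 + (h * v0) %/ s * conjp s).
    have E : h * v0 = (h * v0) %/ s * s + u by exact: divp_eq.
    have -> : u = h * v0 - (h * v0) %/ s * s.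
      by apply/eqP; rewrite eq_sym subr_eq [X in _ == X]addrC; apply/eqP; exact: E.
    rewrite -{1}[h]mulr1 -uv; ring.
  exact: dvdp_mulr.
rewrite dvdp_eq; set v : {poly R[i]} := _ %/ s => /eqP vE.
have su : (size u < size s)%N by rewrite ltn_modp.
have sv : (size v <= N)%N.
  have [->|v0'] := eqVneq v 0; first by rewrite size_poly0.
  have : (size (h - conjp s * u)%R <= (N + size s).-1)%N.
    rewrite (leq_trans (size_polyD _ _))// geq_max; apply/andP; split.
      by rewrite (leq_trans (size_scale_leq _ _))// size_map_poly.
    rewrite size_polyN (leq_trans (size_polyMleq _ _))// size_conjp.
    by move: (size u) (size s) su sN ss0; clear; lia.
  by rewrite vE size_mul//; move: (size v) (size s) ss0; clear; lia.
exists (2^-1 *: (u - conjp v)) => [|x].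
  rewrite (leq_trans (size_scale_leq _ _))// (leq_trans (size_polyD _ _))//.
  by rewrite size_polyN size_conjp geq_max sv andbT (leq_trans (ltnW su)).
have /(congr1 (fun P => P.[x%:C])) := vE.
rewrite hornerD hornerN !hornerM horner_conjp /h hornerZ horner_map /=.
rewrite hornerZ hornerD hornerN horner_conjp.
case: (s.[_]) => a b; case: (u.[_]) => c d; case: (v.[_]) => f g.
move=> [h1 h2].
have -> : (2^-1 : R[i]) = (2^-1 : R)%:C by rewrite fmorphV rmorph_nat.
rewrite mulrCA imZ /=; move: h1 h2; set y := H.[x]; lra.
Qed.

(** The condition on [e] reads e < tau / sqrt (1 + tau ^ 2), and the last hypothesis is |p / q -
    exp(i w x)| <= e multiplied by |q exp(- i w x / 2)|. Such an approximant yields a strictly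
    smaller slope, which a minimal [tau] excludes. *)
Lemma cone_improve N w tau e s p q : 0 < tau -> s != 0 -> (size s <= N)%N ->
  coprimep s (conjp s) -> cone w tau s ->
  (size p <= N)%N -> (size q <= N)%N -> 0 <= e ->
  e ^+ 2 * (1 + tau ^+ 2) < tau ^+ 2 ->
  (forall x, -1 <= x <= 1 -> q.[x%:C] != 0) ->
  (forall x, -1 <= x <= 1 ->
    cabs (twist w p x - q.[x%:C] * (cos (w * x / 2) +i* sin (w * x / 2))) <=
      e * cabs q.[x%:C]) ->
  exists t s', [/\ 0 <= t < tau, s' != 0, (size s' <= N)%N & cone w t s'].
Proof.
move=> tau0 s0 sN cop cs pN qN e0 etau q0 pq.
have sr x : s.[x%:C] != 0.
  apply/negP => /eqP sx; have /coprimep_root := cop.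
  by move=> /(_ x%:C); rewrite /root sx eqxx horner_conjp sx conjc0 eqxx => /(_ isT).
have ss0 : (0 < size s)%N by rewrite lt0n size_poly_eq0.
(* [D] is the numerator of p / q - s / conj s, so on [-1, 1] [F] is positive exactly where this
   difference exceeds [e] in modulus. *)
pose D := p * conjp s - q * s.
pose F := re_poly (D * conjp D) - (e ^+ 2) *: re_poly ((q * s) * conjp (q * s)).
have re_conj z : re (z * z^*%C) = cabs z ^+ 2.
  by rewrite sqr_cabs; case: z => a b /=; ring.
have FE x : F.[x] = cabs D.[x%:C] ^+ 2 - (e * (cabs q.[x%:C] * cabs s.[x%:C])) ^+ 2.
  rewrite /F hornerD hornerN hornerZ !re_horner hornerM horner_conjp re_conj.
  by rewrite hornerM horner_conjp re_conj hornerM cabsM !exprMn.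
have sD : (size D <= (N + size s).-1)%N.
  rewrite (leq_trans (size_polyD _ _))// geq_max size_polyN; apply/andP; split.
    by rewrite (leq_trans (size_polyMleq _ _))// size_conjp; move: (size p) (size s) pN ss0; clear; lia.
  by rewrite (leq_trans (size_polyMleq _ _))//; move: (size q) (size s) qN ss0; clear; lia.
(* With this k, [F] has size at most 2 k + 1, so the sign polynomial has size at most k + 1, the
   bound that [bezout_im] asks for. *)
have [k kE] : exists k, (N + size s).-1 = k.+1.
  have : (0 < N)%N by apply: leq_trans sN.
  by move: ss0; case: (size s) => // m _; case: (N) => // n _; exists (n + m)%N; rewrite addSn addnS.
have sF : (size F <= k.*2.+1)%N.
  rewrite (leq_trans (size_polyD _ _))// geq_max size_polyN; apply/andP; split.
    rewrite (leq_trans (size_re_poly _))// (leq_trans (size_polyMleq _ _))// size_conjp.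
    by move: (size D) sD => m; rewrite kE; clear; lia.
  rewrite (leq_trans (size_scale_leq _ _))//.
  rewrite (leq_trans (size_re_poly _))// (leq_trans (size_polyMleq _ _))// size_conjp.
  have : (size (q * s)%R <= k.+1)%N.
    by rewrite -kE (leq_trans (size_polyMleq _ _))//; move: (size q) (size s) qN ss0; clear; lia.
  by move: (size (q * s)%R) => m; clear; lia.
pose c x : R[i] := cos (w * x / 2) -i* sin (w * x / 2).
have cc x : c x * (c x)^*%C = 1.
  have := cos2Dsin2 (w * x / 2); rewrite /c; move: (cos _) (sin _) => a b h.
  by apply/eqP; rewrite eq_complex /=; apply/andP; split; apply/eqP; [lra|ring].
have cJ x : (cos (w * x / 2) +i* sin (w * x / 2)) = (c x)^*%C by rewrite /c /= opprK.
have gen (P Q a a' b b' : R[i]) : b * b' = 1 ->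
    P * a' - Q * a = (P * b - Q * b') * (a' * b') + Q * b' * (a' * b' - a * b).
  move=> h; rewrite -[LHS]mulr1 -h; ring.
(* In modulus the first summand is |q s| times the error of p / q, and the second is |q s| times the
   error of s / conj s. *)
have DE x : D.[x%:C] = (twist w p x - q.[x%:C] * (c x)^*%C) * (twist w s x)^*%C
    + q.[x%:C] * (c x)^*%C * ((twist w s x)^*%C - twist w s x).
  rewrite /D hornerD hornerN !hornerM horner_conjp /twist -/(c x).
  by rewrite [(_ * c x)^*%C]rmorphM /=; apply: gen; exact: cc.
have im2 z : z^*%C - z = (- 2 * im z)%:C * 'i%C.
  by case: z => a b; apply/eqP; rewrite eq_complex /=; apply/andP; split; apply/eqP; ring.
have ci : cabs ('i%C : R[i]) = 1 by rewrite /= expr0n /= expr1n add0r sqrtr1.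
have cR (r : R) : cabs r%:C = `|r| by rewrite /= expr0n /= addr0 sqrtr_sqr.
have ccx x : cabs (c x)^*%C = 1 by rewrite cabs_conj cabs_half.
(* p / q interpolates exp(i w x) up to e wherever s / conj s is exact, and
   differs from s / conj s by more than e at the extremal points. *)
have Fphi x : -1 <= x <= 1 -> 0 < F.[x] -> im (twist w s x) != 0.
  move=> xI; apply: contraTneq => im0; rewrite -leNgt FE subr_le0.
  rewrite lerXn2r ?nnegrE ?cabs_ge0 ?mulr_ge0 ?cabs_ge0//.
  rewrite DE im2 im0 mulr0 mul0r mulr0 addr0 cabsM cabs_conj cabs_twist.
  by rewrite mulrA ler_wpM2r ?cabs_ge0// -cJ pq.
have [H sH HP] := sign_poly (@continuous_im_twist R w s) sF Fphi.
rewrite -kE in sH.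
have [T sT TE] := bezout_im s0 sN cop sH.
have imST x : im ((twist w s x)^*%C * twist w T x) = - H.[x].
  rewrite -TE /twist -/(c x) [(_ * c x)^*%C]rmorphM /=; congr im.
  by rewrite mulrACA [(c x)^*%C * _]mulrC cc mulr1.
have rs0 x : -1 <= x <= 1 -> 0 < re (twist w s x).
  move=> xI; have := cs x xI; have := sr x; rewrite -(twist_eq0 w).
  case: (twist w s x) => a b; rewrite eq_complex /= negb_and => ab h.
  have ta : 0 <= tau * a := le_trans (normr_ge0 _) h.
  rewrite lt_def; have -> : 0 <= a by rewrite pmulr_rge0 in ta.
  rewrite andbT; apply: contraTneq ab => a0; move: h; rewrite a0 mulr0 normr_le0 => ->.
  by rewrite eqxx.
(* On the boundary of the cone |Im twist s| > e |s|. The second summand of [D] has modulus 2 |q| |Im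
   twist s| and the first at most e |q s|, so |D| > e |q s|. *)
have extr x (sg : R) : -1 <= x <= 1 -> sg ^+ 2 = 1 ->
    im (twist w s x) = sg * (tau * re (twist w s x)) -> 0 < F.[x].
  move=> xI sg1 ext; rewrite FE subr_gt0 ltrXn2r ?nnegrE ?cabs_ge0 ?mulr_ge0 ?cabs_ge0//.
  have r0 := rs0 x xI; have qx : 0 < cabs q.[x%:C].
    by rewrite lt_def cabs_ge0 cabs_eq0 q0.
  have tri : cabs q.[x%:C] * (2 * `|im (twist w s x)|) <= cabs D.[x%:C] +
      e * cabs q.[x%:C] * cabs s.[x%:C].
    have -> : cabs q.[x%:C] * (2 * `|im (twist w s x)|) =
        cabs (q.[x%:C] * (c x)^*%C * ((twist w s x)^*%C - twist w s x)).
      by rewrite !cabsM ccx im2 cabsM ci cR normrM normrN normr_nat; ring.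
    have -> : q.[x%:C] * (c x)^*%C * ((twist w s x)^*%C - twist w s x) = D.[x%:C] -
      (twist w p x - q.[x%:C] * (c x)^*%C) * (twist w s x)^*%C by rewrite DE; ring.
    apply: (le_trans (le_normcD _ _)); rewrite normcN lerD2l cabsM cabs_conj cabs_twist.
    by rewrite ler_wpM2r ?cabs_ge0// -cJ pq.
  have big : e * cabs s.[x%:C] < `|im (twist w s x)|.
    rewrite -(@ltr_pXn2r _ 2) ?nnegrE ?mulr_ge0 ?cabs_ge0//.
    rewrite exprMn real_normK ?num_real// -(cabs_twist w) sqr_cabs ext.
    move: (re (twist w s x)) r0 => a a0; rewrite !exprMn sg1 mul1r.
    have a2 : 0 < a ^+ 2 by rewrite exprn_gt0.
    move: etau; clear -a2; nra.
  have := mulr_gt0 qx (_ : 0 < `|im (twist w s x)| - e * cabs s.[x%:C]).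
  rewrite subr_gt0 big => /(_ isT); move: tri; lra.
(* The two boundary rays are treated separately. Where s touches one, a (tau f - sg g) = sg H with a
   = Re twist s and f + i g = twist T, and sg H > 0 because H has the sign of Im twist s. *)
have pert (sg : R) : sg ^+ 2 = 1 -> exists2 d, 0 < d & forall x, -1 <= x <= 1 ->
    0 < (tau * re (twist w s x) - sg * im (twist w s x)) +
      d * (tau * re (twist w T x) - sg * im (twist w T x)).
  move=> sg1.
  have cL U : continuous (fun x => tau * re (twist w U x) - sg * im (twist w U x)).
    have ccst (a : R) : continuous (fun _ : R => a) by exact: cst_continuous.
    exact: (continuous_add (continuous_mul (ccst _) (@continuous_re_twist R w U))
      (continuous_opp (continuous_mul (ccst _) (@continuous_im_twist R w U)))).
  apply: (positive_perturbation _ (cL s) (cL T)); first lra.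
    move=> x /cs; have : sg = 1 \/ sg = -1.
      by have := eqf_sqr sg 1; rewrite sg1 expr1n eqxx => /esym/orP[]/eqP ->; [left|right].
    by rewrite ler_norml => -[->|->]; lra.
  move=> x xI L0.
  have ext : im (twist w s x) = sg * (tau * re (twist w s x)).
    have -> : tau * re (twist w s x) = sg * im (twist w s x) by lra.
    by rewrite mulrA -expr2 sg1 mul1r.
  have HP' := HP x xI (extr x sg xI sg1 ext).
  have r0 := rs0 x xI; have := imST x.
  rewrite ext in HP'; move: ext HP' r0; case: (twist w s x) => a b; case: (twist w T x) => f g /=.
  move=> -> HP' a0 E.
  have : 0 < a * (tau * f - sg * g).
    have -> : a * (tau * f - sg * g) = sg * H.[x] + (sg ^+ 2 - 1) * (- tau * a * f).
      have -> : H.[x] = - (a * g + - (sg * (tau * a)) * f) by rewrite E opprK.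
      by ring.
    rewrite sg1 subrr mul0r addr0.
    have E2 : H.[x] * (sg * (tau * a)) = sg * H.[x] * (tau * a) by ring.
    by move: HP'; rewrite E2 pmulr_lgt0// mulr_gt0.
  by rewrite pmulr_rgt0.
have [d1 d10 P1] := pert 1 (expr1n _ _).
have n1 : (-1 : R) ^+ 2 = 1 by rewrite sqrrN expr1n.
have [d2 d20 P2] := pert (-1) n1.
pose d := Num.min d1 d2.
have d0 : 0 < d by rewrite lt_min d10.
have [dd1 dd2] : d <= d1 /\ d <= d2 by split; rewrite /d ge_min lexx ?orbT.
pose s1 := s + d%:C *: T.
(* An affine function that is nonnegative at 0 and positive at b is positive on ]0, b], so the
   smaller step serves both rays. *)
have mix (L1 L2 b : R) : 0 <= L1 -> d <= b -> 0 < b -> 0 < L1 + b * L2 -> 0 < L1 + d * L2.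
  move=> L10 db b0 L; have [L20|L20] := leP 0 L2; last by nra.
  move: L20; rewrite le_eqVlt => /predU1P[L20|L20]; first by move: L; rewrite -L20 !mulr0.
  by rewrite ltr_wpDl// mulr_gt0.
have Q x : -1 <= x <= 1 -> `|im (twist w s1 x)| < tau * re (twist w s1 x).
  move=> xI; have := cs x xI; rewrite ler_norml => /andP[c1 c2].
  have h1 : 0 < (tau * re (twist w s x) - 1 * im (twist w s x)) +
      d * (tau * re (twist w T x) - 1 * im (twist w T x)).
    by apply: (mix _ _ d1 _ dd1 d10 (P1 x xI)); lra.
  have h2 : 0 < (tau * re (twist w s x) - -1 * im (twist w s x)) +
      d * (tau * re (twist w T x) - -1 * im (twist w T x)).
    by apply: (mix _ _ d2 _ dd2 d20 (P2 x xI)); lra.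
  rewrite /s1 twist_add reD imD reZ imZ ltr_norml.
  have := h1; have := h2; lra.
have ccst (a : R) : continuous (fun _ : R => a) by exact: cst_continuous.
have c1 := continuous_mul (ccst tau) (@continuous_re_twist R w s1).
have ci1 := @continuous_im_twist R w s1.
have cr1 := continuous_opp (@continuous_re_twist R w s1).
(* The inequality is now strict on a compact interval, so it survives adding a small multiple of -
   Re twist s1, which lowers the slope. *)
have [|||g1 g10 G1] := @positive_perturbation R _ _ (-1) 1 _
  (continuous_add c1 (continuous_opp ci1)) cr1; first lra.
- by move=> x /Q; rewrite ltr_norml; lra.
- by move=> x /Q; rewrite ltr_norml; lra.
have [|||g2 g20 G2] := @positive_perturbation R _ _ (-1) 1 _
  (continuous_add c1 ci1) cr1; first lra.
- by move=> x /Q; rewrite ltr_norml; lra.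
- by move=> x /Q; rewrite ltr_norml; lra.
pose g := Num.min g1 g2.
have g0 : 0 < g by rewrite lt_min g10.
have [gg1 gg2] : g <= g1 /\ g <= g2 by split; rewrite /g ge_min lexx ?orbT.
have rs1 x : -1 <= x <= 1 -> 0 < re (twist w s1 x).
  by move=> /Q h; have := le_lt_trans (normr_ge0 _) h; rewrite pmulr_rgt0.
have K x : -1 <= x <= 1 -> `|im (twist w s1 x)| < (tau - g) * re (twist w s1 x).
  move=> xI; have := G1 x xI; have := G2 x xI; have := rs1 x xI.
  rewrite ltr_norml; move: (re _) (im _) => a b a0 h1 h2.
  by apply/andP; split; nra.
exists (tau - g), s1; split.
- apply/andP; split; last lra.
  have I0 : -1 <= (0 : R) <= 1 by lra.
  have := le_lt_trans (normr_ge0 _) (K 0 I0); rewrite pmulr_lgt0 ?rs1//.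
  by move=> /ltW.
- apply/negP => /eqP E; have I0 : -1 <= (0 : R) <= 1 by lra.
  by have := rs1 0 I0; rewrite E /twist horner0 mul0r ltxx.
- by rewrite (leq_trans (size_polyD _ _))// geq_max sN (leq_trans (size_scale_leq _ _)).
- by move=> x /K /ltW.
Qed.
End Improvement2.

(** * The cone for slopes 0 and large *)

Section ConeBounds.
Context {R : realType}.
Local Open Scope complex_scope.
Implicit Types (s : {poly R[i]}) (x y w tau : R).

(** On ]0, (n + 1) pi[ each sign change of sin, at a multiple of pi, is cancelled by a linear
    factor; the product is nonnegative there. *)
Definition sin_prod n y : R := sin y * \prod_(k < n) (k.+1%:R * pi - y).

Lemma sin_prodS n y : sin_prod n.+1 y = (y - pi) * sin_prod n (y - pi).
Proof.
rewrite /sin_prod big_ord_recl -[in sin y](subrK pi y) sinDpi.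
rewrite (eq_bigr (fun k : 'I_n => k.+1%:R * pi - (y - pi))) => [|k _].
  by rewrite mul1r; ring.
have -> : (lift ord0 k).+1%:R = k.+1%:R + 1 :> R by rewrite natr1.
by ring.
Qed.

Lemma sin_prod_gt0 n y : 0 < y < pi -> 0 < sin_prod n y.
Proof.
move=> yI; rewrite mulr_gt0 ?sin_gt0_pi// prodr_gt0// => k _.
have := pi_gt0 R; rewrite -natr1 => p0.
have : (0 : R) <= k%:R * pi by rewrite mulr_ge0// ltW.
lra.
Qed.

(** The zeros are multiples of pi, and a shift by pi / 2 lands strictly between two consecutive
    ones. The induction translates y by pi. *)
Lemma sin_prod_zeros n y : 0 < y < n.+1%:R * pi ->
  0 <= sin_prod n y /\ (sin_prod n y = 0 -> 0 < sin_prod n (y + pi / 2)).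
Proof.
have p0 := pi_gt0 R.
have case0 m z : 0 < z < pi ->
    0 <= sin_prod m z /\ (sin_prod m z = 0 -> 0 < sin_prod m (z + pi / 2)).
  by move=> /(sin_prod_gt0 m) h; split; [exact: ltW|move=> E; move: h; rewrite E ltxx].
elim: n y => [|n IH] y yI; first by apply: case0; rewrite mul1r in yI.
have [yp|py|yp] := ltgtP y pi; first by apply: case0; lra.
  have [|h1 h2] := IH (y - pi); first by move: yI; rewrite -[n.+2%:R]natr1; lra.
  rewrite sin_prodS; split; first by rewrite mulr_ge0//; lra.
  move=> /eqP; rewrite mulf_eq0 subr_eq0 gt_eqF//= => /eqP/h2 h.
  rewrite sin_prodS mulr_gt0//; first lra.
  by rewrite -addrA [pi / 2 - pi]addrC addrA.
rewrite yp sin_prodS subrr mul0r lexx; split=> // _.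
rewrite sin_prodS addrAC subrr add0r mulr_gt0 ?divr_gt0//.
by apply: sin_prod_gt0; lra.
Qed.

(** Two polynomials whose twists have real parts [sin_prod] at y and at y + pi / 2, the second with
    a small weight, add up to some s with Re twist s > 0 on [-1, 1]. By compactness |Im twist s| is
    then at most a multiple of Re twist s. *)
Lemma cone_nonempty n w : 0 < w -> w < n.+1%:R * pi ->
  exists (tau : R) s, [/\ 0 <= tau, s != 0, (size s <= n.+1)%N & cone w tau s].
Proof.
move=> w0 wn; have p0 := pi_gt0 R.
(* The centre of ]0, (n + 1) pi[: since w < (n + 1) pi, the point w x / 2 + c stays in this interval
   for |x| <= 1. *)
pose c : R := n.+1%:R * pi / 2.
pose Y (d : R) : {poly R} := \prod_(k < n) ((k.+1%:R * pi - (c + d))%:P - (w / 2) *: 'X).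
have sY d : (size (Y d) <= n.+1)%N.
  rewrite /Y -[X in (_ <= X.+1)%N](card_ord n) -sum1_card.
  elim/big_rec2: _ => [|k m P _ IH]; first by rewrite size_poly1.
  rewrite (leq_trans (size_polyMleq _ _))//.
  have : (size ((k.+1%:R * pi - (c + d))%:P - (w / 2) *: 'X)%R <= 2)%N.
    rewrite (leq_trans (size_polyD _ _))// geq_max size_polyN.
    rewrite (leq_trans (size_polyC_leq1 _))//=.
    by rewrite (leq_trans (size_scale_leq _ _))// size_polyX.
  by move: (size m) (size _) IH => u v; clear; lia.
have YE d x : (Y d).[x] = \prod_(k < n) (k.+1%:R * pi - (w * x / 2 + c + d)).
  rewrite /Y horner_prod; apply: eq_bigr => k _.
  by rewrite hornerD hornerN hornerZ hornerC hornerX; ring.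
pose e : R[i] := cos c -i* sin c.
pose tr (P : {poly R}) := map_poly (real_complex R) P.
(* The factor i turns the real part from cos into sin. Without it, in [sB], cos y = sin (y + pi / 2)
   supplies the shifted product. *)
pose sA := (e * 'i%C) *: tr (Y 0).
pose sB := e *: tr (Y (pi / 2)).
have eE x : e * (cos (w * x / 2) -i* sin (w * x / 2)) =
    cos (w * x / 2 + c) -i* sin (w * x / 2 + c).
  by rewrite cosD sinD /e; apply/eqP; rewrite eq_complex /=; apply/andP; split; apply/eqP; ring.
have SA x : re (twist w sA x) = sin_prod n (w * x / 2 + c).
  have ac (a b u v : R[i]) : a * b * u * v = a * v * (b * u) by ring.
  rewrite /twist /sA hornerZ horner_map ac eE.
  by rewrite /sin_prod YE addr0 /=; ring.
have SB x : re (twist w sB x) = sin_prod n (w * x / 2 + c + pi / 2).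
  rewrite /twist /sB hornerZ horner_map mulrAC eE.
  by rewrite /sin_prod YE sinDpihalf /=; ring.
have yI x : -1 <= x <= 1 -> 0 < w * x / 2 + c < n.+1%:R * pi.
  by rewrite /c => xI; apply/andP; split; nra.
have [|||d d0 dP] := @positive_perturbation R _ _ (-1) 1 _
    (@continuous_re_twist R w sA) (@continuous_re_twist R w sB); first lra.
- by move=> x /yI/sin_prod_zeros[h _]; rewrite SA.
- by move=> x /yI/sin_prod_zeros[_ h]; rewrite SA SB.
pose s := sA + d%:C *: sB.
have rs x : -1 <= x <= 1 -> 0 < re (twist w s x).
  by move=> /dP; rewrite /s twist_add reD reZ.
have cr := @continuous_re_twist R w s; have ci := @continuous_im_twist R w s.
have pert (g : R -> R) : continuous g -> exists2 d, 0 < d &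
    forall x, -1 <= x <= 1 -> 0 < re (twist w s x) + d * g x.
  move=> cg; apply: (positive_perturbation _ cr cg); first lra.
    by move=> x /rs/ltW.
  by move=> x /rs h E; move: h; rewrite E ltxx.
have [d1 d10 D1] := pert _ ci.
have [d2 d20 D2] := pert _ (continuous_opp ci).
pose m := Num.min d1 d2.
have m0 : 0 < m by rewrite lt_min d10.
have [m1 m2] : m <= d1 /\ m <= d2 by split; rewrite /m ge_min lexx ?orbT.
exists m^-1, s; split.
- by rewrite invr_ge0 ltW.
- apply/negP => /eqP E; have I0 : -1 <= (0 : R) <= 1 by lra.
  by have := rs 0 I0; rewrite E /twist horner0 mul0r ltxx.
- rewrite (leq_trans (size_polyD _ _))// geq_max; apply/andP; split.
    by rewrite (leq_trans (size_scale_leq _ _))// size_map_poly.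
  by rewrite !(leq_trans (size_scale_leq _ _))// size_map_poly.
move=> x xI; have := D1 x xI; have := D2 x xI; have := rs x xI.
rewrite -ler_pdivrMl ?invr_gt0// invrK.
move: (re _) (im _) => a b a0 h1 h2.
have [b0|/ltW b0] := leP 0 b.
  by rewrite (ger0_norm b0); nra.
by rewrite (ler0_norm b0); nra.
Qed.

(** Slope 0 makes the twist real, so conj s = s exp(- i w x) on [-1, 1]. Comparing x with x + h
    eliminates the exponential: conj s(x + h) s(x) = k s(x + h) conj s(x) with the constant k =
    exp(- i w h). For s nonzero the leading coefficients force k = 1, although sin (w h) > 0. *)
Lemma cone0 w s : 0 < w -> cone w 0 s -> s = 0.
Proof.
move=> w0 cs; apply/eqP/negPn/negP => s0.
(* h <= 1 keeps x + h in [-1, 1] for x in [-1, 0], and w h <= 1 < pi keeps sin (w h) positive. *)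
pose h := Num.min 1 w^-1.
have h0 : 0 < h by rewrite lt_min ltr01 invr_gt0.
have h1 : h <= 1 by rewrite ge_min lexx.
have wh : w * h <= 1.
  by rewrite -ler_pdivlMl// mulr1 ge_min lexx orbT.
pose c x : R[i] := cos (w * x / 2) -i* sin (w * x / 2).
pose k : R[i] := cos (w * h) -i* sin (w * h).
have ck x : c (x + h) ^+ 2 = k * c x ^+ 2.
  have -> : c (x + h) = c x * (cos (w * h / 2) -i* sin (w * h / 2)).
    rewrite /c mulrDr mulrDl cosD sinD.
    by apply/eqP; rewrite eq_complex /=; apply/andP; split; apply/eqP; ring.
  rewrite exprMn mulrC; congr (_ * _); rewrite /k.
  set t := w * h / 2; have -> : w * h = t + t by exact: splitr.
  rewrite cosD sinD.
  by apply/eqP; rewrite eq_complex /=; apply/andP; split; apply/eqP; ring.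
have Sr x : -1 <= x <= 1 -> (s.[x%:C])^*%C = s.[x%:C] * c x ^+ 2.
  move=> xI; have := cs x xI; rewrite mul0r normr_le0 => /eqP.
  have cc : c x * (c x)^*%C = 1.
    have := cos2Dsin2 (w * x / 2); rewrite /c; move: (cos _) (sin _) => a b E.
    by apply/eqP; rewrite eq_complex /=; apply/andP; split; apply/eqP; [lra|ring].
  move=> im0; have SE : (twist w s x)^*%C = twist w s x.
    by move: im0; case: (twist w s x) => a b /= ->; rewrite oppr0.
  have gen (a a' b b' : R[i]) : a' * b' = a * b -> b * b' = 1 -> a' = a * b ^+ 2.
    by move=> ab bb; rewrite expr2 mulrA -ab -mulrA [b' * b]mulrC bb mulr1.
  by apply: gen cc; move: SE; rewrite /twist rmorphM.
pose sh (p : {poly R[i]}) := p \Po ('X + h%:C%:P).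
have E : sh (conjp s) * s - k *: (sh s * conjp s) = 0.
  apply: (@poly_eq0_itv R _ (-1) 0); first lra.
  move=> x xI; rewrite hornerD hornerN hornerZ !hornerM /sh !horner_comp.
  rewrite !hornerD !hornerX !hornerC -rmorphD !horner_conjp.
  rewrite (Sr x) ?(Sr (x + h)) ?ck; [|lra|lra].
  by rewrite /=; ring.
have lsh p : lead_coef (sh p) = lead_coef p.
  by rewrite lead_coef_comp ?size_XaddC// lead_coefXaddC expr1n mulr1.
have : lead_coef (sh (conjp s) * s) = lead_coef (k *: (sh s * conjp s)).
  by move/eqP: E; rewrite subr_eq0 => /eqP ->.
rewrite lead_coefZ !lead_coefM !lsh [lead_coef s * _]mulrC -[LHS]mul1r.
have lc0 : lead_coef (conjp s) * lead_coef s != 0.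
  by rewrite mulf_neq0// lead_coef_eq0// -size_poly_eq0 size_conjp size_poly_eq0.
move=> /(mulIf lc0) /(congr1 (fun z : R[i] => - im z)).
rewrite /k /= opprK oppr0 => /esym/eqP; rewrite gt_eqF// sin_gt0_pi// mulr_gt0//=.
by rewrite (le_lt_trans wh)// (lt_le_trans _ (pi_ge2 R))// ltr1n.
Qed.
End ConeBounds.

(** * Rational functions on the imaginary axis *)

Section RatFun.
Context {R : realType}.
Local Open Scope complex_scope.
Implicit Types (p q s : {poly R[i]}) (x w e : R) (z v : R[i]) (r : ratfun R).

(** For k = i this carries evaluation on the imaginary axis to the real line; k = - i undoes it. *)
Definition rotp (k : R[i]) p : {poly R[i]} := p \Po (k *: 'X).

Lemma size_rotp k p : k != 0 -> size (rotp k p) = size p.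
Proof. by move=> k0; rewrite size_comp_poly2// size_scale// size_polyX. Qed.

Lemma rotpK k l p : k * l = 1 -> rotp k (rotp l p) = p.
Proof.
move=> kl; rewrite /rotp -comp_polyA comp_polyZ comp_polyX scalerA mulrC kl.
by rewrite scale1r comp_polyXr.
Qed.

Lemma horner_rotp p x : (rotp 'i%C p).[x%:C] = p.[imag x].
Proof.
rewrite /rotp horner_comp hornerZ hornerX; congr p.[_].
by apply/eqP; rewrite eq_complex /=; apply/andP; split; apply/eqP; ring.
Qed.

Lemma i_neq0 : ('i%C : R[i]) != 0.
Proof. by rewrite eq_complex /= oner_eq0 andbF. Qed.

Lemma mul_Ni_i : (- 'i%C) * 'i%C = 1 :> R[i].
Proof. by rewrite mulNr -expr2 sqr_i opprK. Qed.

Lemma mul_i_Ni : 'i%C * (- 'i%C) = 1 :> R[i].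
Proof. by rewrite mulrC mul_Ni_i. Qed.

Lemma coprime_rotp k p q : coprimep p q -> coprimep (rotp k p) (rotp k q).
Proof. exact: coprimep_comp_poly. Qed.

Lemma frac_eq p q p' q' : q != 0 -> q' != 0 ->
  (p%:F / q%:F == p'%:F / q'%:F) = (p * q' == p' * q).
Proof.
move=> q0 q'0; rewrite eqr_div ?tofrac_eq0//.
by rewrite -!tofracM tofrac_eq.
Qed.

Lemma reduced_fraction n r : ratfun_deg_le n r -> exists p q,
  [/\ coprimep p q, (size p <= n.+1)%N, (size q <= n.+1)%N, q != 0 & r = p%:F / q%:F].
Proof.
move=> [p [q [sp sq q0 ->]]].
have pE := divpK (dvdp_gcdl p q); have qE := divpK (dvdp_gcdr p q).
have q'0 : q %/ gcdp p q != 0.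
  by apply: contra_neq q0 => E; rewrite -qE E mul0r.
exists (p %/ gcdp p q), (q %/ gcdp p q); split=> //.
- by rewrite coprimep_div_gcd// q0 orbT.
- by rewrite (leq_trans (leq_divp _ _)).
- by rewrite (leq_trans (leq_divp _ _)).
apply/eqP; rewrite frac_eq//; apply/eqP; move: pE qE.
set g := gcdp p q; set p' := p %/ g; set q' := q %/ g => pE qE.
by rewrite -[in LHS]pE -[in RHS]qE; ring.
Qed.

(** If q vanished at z, cross-multiplication would make p vanish there too, against coprimality.
    Poles and values can thus be read off any reduced form. *)
Lemma has_value_reduced p q r z v : coprimep p q -> q != 0 ->
  r = p%:F / q%:F -> has_value r z v -> q.[z] != 0 /\ v = p.[z] / q.[z].
Proof.
move=> cop q0 -> [p1 [q1 [q1z E ->]]].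
have q10 : q1 != 0 by apply: contra_neq q1z => ->; rewrite horner0.
move/eqP: E; rewrite frac_eq// => /eqP/(congr1 (horner^~ z)).
rewrite !hornerM => E; have qz : q.[z] != 0.
  apply/negP => /eqP qz; move: E; rewrite qz mulr0 => /eqP.
  rewrite mulf_eq0 (negPf q1z) orbF => /eqP pz.
  by have /coprimep_root := cop => /(_ z); rewrite /root pz qz eqxx => /(_ isT).
by split=> //; apply/eqP; rewrite eqr_div// E.
Qed.

Lemma reval_reduced p q z : coprimep p q -> q.[z] != 0 ->
  reval (p%:F / q%:F : ratfun R) z = p.[z] / q.[z].
Proof.
move=> cop qz; have q0 : q != 0 by apply: contra_neq qz => ->; rewrite horner0.
have h : has_value (p%:F / q%:F : ratfun R) z (p.[z] / q.[z]) by exists p, q.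
by have [] := has_value_reduced cop q0 erefl (xgetPex 0 (ex_intro _ _ h)).
Qed.

Lemma regular_reduced p q z : coprimep p q -> q != 0 ->
  regular_at (p%:F / q%:F : ratfun R) z <-> q.[z] != 0.
Proof.
move=> cop q0; split=> [[v] /(has_value_reduced cop q0 erefl)[]//|qz].
by exists (p.[z] / q.[z]), p, q.
Qed.

(** The value exp(- i w x / 2); the square of its conjugate is the target exp(i w x). *)
Definition hexp w x : R[i] := cos (w * x / 2) -i* sin (w * x / 2).

Lemma half_conj w x : hexp w x * (hexp w x)^*%C = 1.
Proof.
have := cos2Dsin2 (w * x / 2); rewrite /hexp; move: (cos _) (sin _) => a b E.
by apply/eqP; rewrite eq_complex /=; apply/andP; split; apply/eqP; [lra|ring].
Qed.

Lemma conj_half w x : (hexp w x)^*%C = cos (w * x / 2) +i* sin (w * x / 2).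
Proof. by rewrite /hexp /= opprK. Qed.

Lemma cexp_half w x : cexp (w%:C * imag x) = (hexp w x)^*%C ^+ 2.
Proof.
have -> : w%:C * imag x = 0 +i* (w * x).
  by apply/eqP; rewrite eq_complex /=; apply/andP; split; apply/eqP; ring.
rewrite /cexp expR0 !mul1r conj_half.
set t := w * x / 2; have -> : w * x = t + t by exact: splitr.
rewrite cosD sinD.
by apply/eqP; rewrite eq_complex /=; apply/andP; split; apply/eqP; ring.
Qed.

Lemma cabs_cexp w x : cabs (cexp (w%:C * imag x)) = 1.
Proof. by rewrite cexp_half expr2 cabsM !cabs_conj cabs_half mulr1. Qed.

Lemma error_le w r e : (exp_error w r <= e%:E)%E <->
  forall x, -1 <= x <= 1 -> regular_at r (imag x) /\
    cabs (reval r (imag x) - cexp (w%:C * imag x)) <= e.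
Proof.
split=> [h x xI|h].
  have : (dist_at r (fun z => cexp (w%:C * z)%R) (imag x) <= e%:E)%E.
    apply: le_trans h; apply: ereal_sup_ubound; exists x; [by rewrite /= in_itv/=|by []].
  by rewrite /dist_at; case: asboolP => //; rewrite lee_fin.
apply: ge_ereal_sup => _ /= [x xI <-]; rewrite in_itv/= in xI.
have [reg le] := h x xI.
by rewrite /dist_at; case: asboolP => // _; rewrite lee_fin.
Qed.

Lemma error_ge0 w r : (0 <= exp_error w r)%E.
Proof.
apply: (@le_trans _ _ (dist_at r (fun z => cexp (w%:C * z)%R) (imag 0))).
  by rewrite /dist_at; case: asboolP => // _; rewrite lee_fin cabs_ge0.
apply: ereal_sup_ubound; exists 0; [|by []].
by rewrite /= in_itv/=; apply/andP; split; lra.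
Qed.

(** The error is multiplied by the denominator and by exp(- i w x / 2), which has modulus 1; this is
    the form used by [cone_improve]. *)
Lemma error_reduced w p q e : coprimep p q -> q != 0 ->
  (exp_error w (p%:F / q%:F)%R <= e%:E)%E <->
  forall x, -1 <= x <= 1 -> (rotp 'i%C q).[x%:C] != 0 /\
    cabs (twist w (rotp 'i%C p) x - (rotp 'i%C q).[x%:C] * (hexp w x)^*%C) <=
      e * cabs (rotp 'i%C q).[x%:C].
Proof.
move=> cop q0; rewrite error_le.
have P x : q.[imag x] != 0 ->
    cabs (twist w (rotp 'i%C p) x - (rotp 'i%C q).[x%:C] * (hexp w x)^*%C) =
    cabs (reval (p%:F / q%:F : ratfun R) (imag x) - cexp (w%:C * imag x)) *
    cabs (rotp 'i%C q).[x%:C].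
  move=> qx; rewrite reval_reduced// cexp_half /twist !horner_rotp -/(hexp w x).
  rewrite -[RHS]mulr1 -(cabs_half w x) -/(hexp w x) -!cabsM; congr cabs.
  have gen (u v b b' : R[i]) : v != 0 -> b * b' = 1 ->
      u * b - v * b' = (u / v - b' ^+ 2) * v * b.
    move=> v0 bb; rewrite !mulrBl divfK//; congr (_ - _).
    by rewrite -[LHS]mulr1 -bb; ring.
  by apply: gen => //; exact: half_conj.
split=> h x xI; have := h x xI.
  move=> [/(regular_reduced _ cop q0) qx le]; rewrite horner_rotp; split=> //.
  by rewrite -horner_rotp P// ler_wpM2r ?cabs_ge0.
move=> []; rewrite horner_rotp => qx; rewrite -horner_rotp P// => le.
split; first exact/(regular_reduced _ cop q0).
by move: le; rewrite ler_pM2r// lt_def cabs_ge0 cabs_eq0 horner_rotp qx.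
Qed.

Lemma unitary_reduced n r : unitary n r -> exists s,
  [/\ (size s <= n.+1)%N, forall x, s.[x%:C] != 0 &
   forall x, regular_at r (imag x) /\
     reval r (imag x) = s.[x%:C] / (s.[x%:C])^*%C].
Proof.
move=> [/reduced_fraction[p [q [cop sp sq q0 ->]]] U].
have q0x x : q.[imag x] != 0 by have [/(regular_reduced _ cop q0)] := U x.
pose P := rotp 'i%C p; pose Q := rotp 'i%C q.
have Qx x : Q.[x%:C] != 0 by rewrite horner_rotp.
have n1 x : cabs P.[x%:C] = cabs Q.[x%:C].
  have [_] := U x; rewrite reval_reduced// !horner_rotp cabsM.
  rewrite ComplexField.Normc.normcV => /divr1_eq; exact.
have Px x : P.[x%:C] != 0 by rewrite -cabs_eq0 n1 cabs_eq0.
have Q0 : Q != 0 by apply: contra_neq (Qx 0) => ->; rewrite horner0.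
have P0 : P != 0 by apply: contra_neq (Px 0) => ->; rewrite horner0.
have copPQ : coprimep P Q by exact: coprime_rotp.
have zz z : z * z^*%C = (cabs z ^+ 2)%:C.
  rewrite sqr_cabs; case: z => a b.
  by apply/eqP; rewrite eq_complex /=; apply/andP; split; apply/eqP; ring.
(* On the real line P / Q = conj Q / conj P, so also P / Q = s / conj s for
   every combination s = a P + conj a conj Q. *)
have PQ : P * conjp P = Q * conjp Q.
  apply/eqP; rewrite -subr_eq0; apply/eqP/(@poly_eq0_itv R _ 0 1) => // x _.
  by rewrite hornerD hornerN !hornerM !horner_conjp !zz n1 subrr.
have : Q %| conjp P.
  by rewrite -(Gauss_dvdpr _ (_ : coprimep Q P)) 1?coprimep_sym// PQ dvdp_mulr.
move=> /dvdpP[V PV].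
have QV : conjp Q = P * V.
  by apply: (mulfI Q0); rewrite -PQ PV; ring.
have V0 : V != 0.
  by apply: contra_neq Q0 => V0; apply/eqP; rewrite -size_poly_eq0 -size_conjp QV V0 mulr0 size_poly0.
(* Conjugation preserves degrees, so conj P = V Q and conj Q = P V leave no room for a nonconstant
   V. *)
have sV : size V = 1%N.
  have := size_conjp P; have := size_conjp Q; rewrite PV QV !size_mul//.
  have : (0 < size P)%N by rewrite lt0n size_poly_eq0.
  have : (0 < size Q)%N by rewrite lt0n size_poly_eq0.
  have : (0 < size V)%N by rewrite lt0n size_poly_eq0.
  by move: (size P) (size Q) (size V); clear; lia.
have [v vE] : exists v, V = v%:P by exists V`_0; apply: size1_polyC; rewrite sV.
(* The choice a = 1 fails only for v = -1, and then a = i gives 2 i. *)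
have [a a0] : exists a : R[i], a + a^*%C * v != 0.
  have [v1|v1] := eqVneq v (-1); last first.
    by exists 1; rewrite conjc1 mul1r addrC addr_eq0.
  exists 'i%C; rewrite v1 mulrN1 subr_eq0 eq_complex /= eqxx /=.
  by apply/eqP; lra.
pose s := a *: P + a^*%C *: conjp Q.
have sx x : s.[x%:C] = P.[x%:C] * (a + a^*%C * v).
  by rewrite /s hornerD !hornerZ QV hornerM vE hornerC; ring.
have s0 x : s.[x%:C] != 0 by rewrite sx mulf_neq0.
exists s; split=> //.
  rewrite (leq_trans (size_polyD _ _))// geq_max; apply/andP; split.
    by rewrite (leq_trans (size_scale_leq _ _))// size_rotp ?i_neq0.
  by rewrite (leq_trans (size_scale_leq _ _))// size_conjp size_rotp ?i_neq0.
move=> x; split; first by have [] := U x.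
rewrite reval_reduced// -!horner_rotp -/P -/Q; apply/eqP.
rewrite eqr_div// ?conjc_eq0//; apply/eqP.
rewrite /s hornerD !hornerZ horner_conjp rmorphD !rmorphM /= !conjcK.
have := congr1 (horner^~ x%:C) PQ; rewrite !hornerM !horner_conjp => E.
by rewrite mulrDr mulrDl mulrCA E; ring.
Qed.

Lemma unitary_of n s : (size s <= n.+1)%N -> coprimep s (conjp s) -> s != 0 ->
  exists2 r, unitary n r & forall x, [/\ s.[x%:C] != 0, regular_at r (imag x) &
     reval r (imag x) = s.[x%:C] / (s.[x%:C])^*%C].
Proof.
move=> sn cop s0.
have sx x : s.[x%:C] != 0.
  apply/negP => /eqP sx; have /coprimep_root := cop => /(_ x%:C).
  by rewrite /root sx eqxx horner_conjp sx conjc0 eqxx => /(_ isT).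
pose p := rotp (- 'i%C) s; pose q := rotp (- 'i%C) (conjp s).
have ni0 : - 'i%C != 0 :> R[i] by rewrite oppr_eq0 i_neq0.
have copr : coprimep p q by exact: coprime_rotp.
have q0 : q != 0 by rewrite -size_poly_eq0 size_rotp// size_conjp size_poly_eq0.
have pi_ x : p.[imag x] = s.[x%:C] by rewrite -horner_rotp rotpK// mul_i_Ni.
have qi x : q.[imag x] = (s.[x%:C])^*%C by rewrite -horner_rotp rotpK ?mul_i_Ni// horner_conjp.
have qx x : q.[imag x] != 0 by rewrite qi conjc_eq0.
have P x : regular_at (p%:F / q%:F : ratfun R) (imag x) /\
    reval (p%:F / q%:F : ratfun R) (imag x) = s.[x%:C] / (s.[x%:C])^*%C.
  split; first exact/(regular_reduced _ copr q0).
  by rewrite reval_reduced// pi_ qi.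
exists (p%:F / q%:F) => [|x]; last by have [] := P x.
split=> [|x].
  by exists p, q; rewrite !size_rotp// size_conjp.
have [? ->] := P x; split=> //.
by rewrite cabsM ComplexField.Normc.normcV cabs_conj divff// cabs_eq0.
Qed.

(** Multiplied by conj s exp(- i w x / 2), the difference becomes twist s - conj (twist s) = 2 i Im
    twist s. *)
Lemma unitary_dist w s x : s.[x%:C] != 0 ->
  cabs (s.[x%:C] / (s.[x%:C])^*%C - cexp (w%:C * imag x)) * cabs s.[x%:C] =
  2 * `|im (twist w s x)|.
Proof.
move=> sx; rewrite cexp_half.
have E : (s.[x%:C] / (s.[x%:C])^*%C - (hexp w x)^*%C ^+ 2) * (s.[x%:C])^*%C * hexp w x =
    twist w s x - (twist w s x)^*%C.
  have gen (a a' b b' : R[i]) : a' != 0 -> b * b' = 1 ->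
      (a / a' - b' ^+ 2) * a' * b = a * b - a' * b'.
    move=> a0 bb; rewrite mulrBl divfK// mulrBl; congr (_ - _).
    by rewrite expr2 -[RHS]mulr1 -bb; ring.
  rewrite [X in _ = _ - X]rmorphM; apply: gen; first by rewrite conjc_eq0.
  exact: half_conj.
rewrite -[cabs s.[_]]cabs_conj -[LHS]mulr1 -(cabs_half w x) -/(hexp w x) -!cabsM E.
have -> : twist w s x - (twist w s x)^*%C = (2 * im (twist w s x))%:C * 'i%C.
  case: (twist w s x) => a b; apply/eqP; rewrite eq_complex /=; apply/andP; split; apply/eqP; ring.
have ci : cabs ('i%C : R[i]) = 1 by rewrite /= expr0n /= expr1n add0r sqrtr1.
have cR (t : R) : cabs t%:C = `|t| by rewrite /= expr0n /= addr0 sqrtr_sqr.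
by rewrite cabsM ci cR mulr1 normrM normr_nat cabs_half.
Qed.

End RatFun.

(** * Errors *)

Section Errors.
Context {R : realType}.
Local Open Scope complex_scope.
Implicit Types (p q s : {poly R[i]}) (x w e tau : R) (r : ratfun R).

Lemma error_unitary_le2 n w r : unitary n r -> (exp_error w r <= 2%:E)%E.
Proof.
move=> [_ U]; apply/error_le => x _; have [reg n1] := U x; split=> //.
rewrite (le_trans (le_normcD _ _))// normcN n1 cabs_cexp; lra.
Qed.

Lemma deg_le_const n (c : R[i]) : ratfun_deg_le n (c%:P%:F / 1%:P%:F : ratfun R).
Proof.
exists c%:P, 1%:P; split=> //; last by rewrite polyC_eq0 oner_eq0.
  by rewrite (leq_trans (size_polyC_leq1 _)).
by rewrite (leq_trans (size_polyC_leq1 _)).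
Qed.

Lemma const1 : (1%:P%:F / 1%:P%:F : ratfun R) = 1.
Proof. by rewrite divff// tofrac_eq0 polyC_eq0 oner_eq0. Qed.

Lemma const0 : (0%:P%:F / 1%:P%:F : ratfun R) = 0.
Proof. by rewrite polyC0 tofrac0 mul0r. Qed.

Lemma unitary1 n : unitary n (1 : ratfun R).
Proof.
split; first by rewrite -const1; exact: deg_le_const.
move=> x; have cop : coprimep (1%:P : {poly R[i]}) 1%:P by exact: coprimep1.
have v1 : (1%:P : {poly R[i]}).[imag x] != 0 by rewrite hornerC oner_eq0.
rewrite -const1; split.
  by apply/(regular_reduced _ cop) => //; rewrite polyC_eq0 oner_eq0.
by rewrite reval_reduced// !hornerC divr1 ComplexField.Normc.normc1.
Qed.

Lemma error0 w : exp_error w (0 : ratfun R) = 1%E.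
Proof.
have cop : coprimep (0%:P : {poly R[i]}) 1%:P by exact: coprimep1.
have n1 : (1%:P : {poly R[i]}) != 0 by rewrite polyC_eq0 oner_eq0.
have v1 z : (1%:P : {poly R[i]}).[z] != 0 by rewrite hornerC oner_eq0.
have E z : reval (0 : ratfun R) z = 0.
  by rewrite -const0 reval_reduced// !hornerC mul0r.
have reg z : regular_at (0 : ratfun R) z by rewrite -const0; apply/(regular_reduced _ cop).
apply/le_anti/andP; split.
  by apply/error_le => x _; rewrite E sub0r normcN cabs_cexp.
apply: ereal_sup_ubound; exists 0.
  by rewrite /= in_itv/=; apply/andP; split; lra.
rewrite /dist_at; case: asboolP => // _.
by rewrite E sub0r normcN cabs_cexp.
Qed.

(** An error of 2 k means |Im twist s| <= k |twist s|, hence |Im| <= tau |Re| as soon as tau >= k /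
    sqrt (1 - k ^ 2). Since k < 1, Re twist s has no zero, so its sign is constant and can be made
    positive by passing to - s. *)
Lemma unitary_cone n w r (k tau : R) : unitary n r -> 0 <= k < 1 -> 0 <= tau ->
  k ^+ 2 * (1 + tau ^+ 2) <= tau ^+ 2 -> (exp_error w r <= (2 * k)%:E)%E ->
  exists s, [/\ s != 0, (size s <= n.+1)%N, cone w tau s &
    forall x, -1 <= x <= 1 -> 0 < re (twist w s x)].
Proof.
move=> U /andP[k0 k1] tau0 ktau /error_le err.
have [s [sn s0 sv]] := unitary_reduced U.
have kS x : -1 <= x <= 1 -> im (twist w s x) ^+ 2 <=
    k ^+ 2 * (re (twist w s x) ^+ 2 + im (twist w s x) ^+ 2).
  move=> xI; have [_] := err x xI; have [_ ->] := sv x => d.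
  have := ler_wpM2r (cabs_ge0 s.[x%:C]) d; rewrite unitary_dist// -mulrA ler_pM2l//.
  rewrite -sqr_cabs cabs_twist -exprMn => h.
  by rewrite -real_normK ?num_real// lerXn2r ?nnegrE ?mulr_ge0 ?cabs_ge0.
have rn x : -1 <= x <= 1 -> re (twist w s x) != 0.
  move=> xI; have := kS x xI; have := s0 x; rewrite -(twist_eq0 w).
  case: (twist w s x) => a b; rewrite eq_complex /= negb_and => ab h.
  apply: contraTneq ab => a0; rewrite a0 eqxx /= negbK.
  move: h; rewrite a0 expr0n /= add0r => h.
  have : b ^+ 2 = 0 by have := sqr_ge0 b; nra.
  by move=> /eqP; rewrite sqrf_eq0.
have cS x : -1 <= x <= 1 -> `|im (twist w s x)| <= tau * `|re (twist w s x)|.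
  move=> /kS; move: (re _) (im _) => a b h.
  rewrite -(@ler_pXn2r _ 2) ?nnegrE ?mulr_ge0// exprMn !real_normK ?num_real//.
  have : b ^+ 2 * (1 - k ^+ 2) <= tau ^+ 2 * a ^+ 2 * (1 - k ^+ 2).
    have := sqr_ge0 a; move: (a ^+ 2) (b ^+ 2) h => A B h A0; nra.
  by rewrite ler_pM2r// subr_gt0 expr_lt1.
have I0 : -1 <= (0 : R) <= 1 by lra.
have sgn x : -1 <= x <= 1 -> 0 < re (twist w s 0) * re (twist w s x).
  move=> xI; rewrite ltNge; apply/negP => le0.
  have cre := @continuous_re_twist R w s.
  have [x0|/ltW x0] := leP 0 x.
    have [y yx yE] := ivt_zero cre x0 le0.
    by have := rn y; rewrite yE eqxx => /(_ _)/negP; apply; lra.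
  rewrite mulrC in le0; have [y yx yE] := ivt_zero cre x0 le0.
  by have := rn y; rewrite yE eqxx => /(_ _)/negP; apply; lra.
have sn0 : s != 0 by apply: contra_neq (s0 0) => ->; rewrite horner0.
have := rn 0 I0; rewrite neq_lt => /orP[neg|pos].
  have rneg x : -1 <= x <= 1 -> re (twist w s x) < 0.
    by move=> /sgn; rewrite nmulr_rgt0.
  have SN x : twist w (- s) x = - twist w s x by rewrite /twist hornerN mulNr.
  have imN (z : R[i]) : im (- z) = - im z by case: z.
  have reN (z : R[i]) : re (- z) = - re z by case: z.
  exists (- s); split; rewrite ?oppr_eq0 ?size_polyN// => x xI; rewrite SN ?imN reN.
    by rewrite normrN; have := cS x xI; rewrite (ltr0_norm (rneg x xI)).
  by rewrite oppr_gt0 rneg.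
have rpos x : -1 <= x <= 1 -> 0 < re (twist w s x).
  by move=> /sgn; rewrite pmulr_rgt0.
exists s; split=> // x xI.
by have := cS x xI; rewrite (gtr0_norm (rpos x xI)).
Qed.

(** In the cone |Im twist s| / |twist s| is at most tau / sqrt (1 + tau ^ 2), which the last
    hypothesis bounds by e. *)
Lemma cone_unitary n w tau e s : 0 <= e -> (size s <= n.+1)%N -> s != 0 ->
  coprimep s (conjp s) -> cone w tau s -> tau ^+ 2 <= e ^+ 2 * (1 + tau ^+ 2) ->
  exists2 r, unitary n r & (exp_error w r <= (2 * e)%:E)%E.
Proof.
move=> e0 sn s0 cop cs etau.
have [r U rv] := unitary_of sn cop s0.
exists r => //; apply/error_le => x xI; have [sx reg ->] := rv x; split=> //.
have sx0 : 0 < cabs s.[x%:C] by rewrite lt_def cabs_ge0 cabs_eq0 sx.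
rewrite -(ler_pM2r sx0) unitary_dist// -mulrA ler_pM2l//.
rewrite -(cabs_twist w) -(@ler_pXn2r _ 2) ?nnegrE ?mulr_ge0 ?cabs_ge0//.
rewrite exprMn sqr_cabs real_normK ?num_real//.
have := cs x xI; move: (re _) (im _) => a b h.
have : `|b| ^+ 2 <= (tau * a) ^+ 2.
  by rewrite lerXn2r ?nnegrE// (le_trans _ h).
rewrite real_normK ?num_real// exprMn => h2.
have t0 : 0 < 1 + tau ^+ 2 by rewrite ltr_pwDl// sqr_ge0.
rewrite -(ler_pM2r t0); move: h2 etau (sqr_ge0 a) (sqr_ge0 b).
move: (a ^+ 2) (b ^+ 2) (e ^+ 2) (tau ^+ 2) => A B E T; clear; nra.
Qed.

(** Take the minimal slope tau. Either e >= tau / sqrt (1 + tau ^ 2), and the optimal s gives a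
    unitary function of error at most 2 e, or [cone_improve] contradicts minimality. *)
Lemma unitary_twice_error n w e r : 0 < w -> w < n.+1%:R * pi -> 0 <= e ->
  ratfun_deg_le n r -> (exp_error w r <= e%:E)%E ->
  exists2 u, unitary n u & (exp_error w u <= (2 * e)%:E)%E.
Proof.
move=> w0 wn e0 /reduced_fraction[p [q [cop sp sq q0 ->]]].
move=> /(error_reduced _ _ cop q0) err.
have [t0 [s0 [t00 s00 s0n cs0]]] := cone_nonempty w0 wn.
have [tau [s' [tau0 s'0 s'n cs' opt]]] := cone_optimum t00 s00 s0n cs0.
have {}tau0 : 0 < tau.
  rewrite lt_def tau0 andbT; apply: contra_neq s'0 => E.
  by apply: (cone0 w0); rewrite -E.
have [s [s_0 ss' cs sc]] := cone_reduced tau0 s'0 cs'.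
have sn : (size s <= n.+1)%N := leq_trans ss' s'n.
have [le|lt] := leP (tau ^+ 2) (e ^+ 2 * (1 + tau ^+ 2)).
  exact: cone_unitary cs le.
have [||||t [s1 [tI s10 s1n cs1]]] := @cone_improve R n.+1 w tau e s
  (rotp 'i%C p) (rotp 'i%C q) tau0 s_0 sn sc cs _ _ e0 lt.
- by rewrite size_rotp// i_neq0.
- by rewrite size_rotp// i_neq0.
- by move=> x /err[].
- by move=> x /err[_]; rewrite conj_half.
by have := opt t s1 _ s10 s1n cs1; case/andP: tI => -> tt /(_ isT); rewrite leNgt tt.
Qed.

Lemma unitary_error_gt0 n w : 0 < w -> w < n.+1%:R * pi ->
  exists2 k : R, 0 < k & (k%:E <= unitary_error n w)%E.
Proof.
move=> w0 wn.
have [t0 [s0 [t00 s00 s0n cs0]]] := cone_nonempty w0 wn.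
have [tau [s [tau0 s_0 sn cs opt]]] := cone_optimum t00 s00 s0n cs0.
have {}tau0 : 0 < tau.
  rewrite lt_def tau0 andbT; apply: contra_neq s_0 => E.
  by apply: (cone0 w0); rewrite -E.
pose t := tau / 2; have tp : 0 < t by rewrite divr_gt0.
(* An error below 2 k would give a cone of slope t = tau / 2, below the minimum. This k is a bound
   for t / sqrt (1 + t ^ 2) from below without a square root. *)
pose k := t / (1 + t).
have kt : k * (1 + t) = t by rewrite divfK// gt_eqF// addr_gt0.
have k0 : 0 < k by rewrite divr_gt0// addr_gt0.
exists (2 * k); first by rewrite mulr_gt0.
apply: le_ereal_inf_tmp => _ /= [r U <-]; rewrite leNgt; apply/negP => /ltW lt.
have [|||s1 [s10 s1n cs1 _]] := @unitary_cone n w r k t U _ _ _ lt.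
- by rewrite (ltW k0)/=; nra.
- exact: ltW.
- have E : (k * (1 + t)) ^+ 2 = t ^+ 2 by rewrite kt.
  by rewrite -[X in _ <= X]E (exprMn _ k) ler_pM2l ?exprn_gt0//; nra.
by have := opt t s1 (ltW tp) s10 s1n cs1; rewrite /t; lra.
Qed.

(** For |v| = |f| = 1 one has |l v - f| ^ 2 = (1 - l) ^ 2 + l |v - f| ^ 2. The bound (1 - l) ^ 2 + l
    e ^ 2 is smallest at l = 1 - e ^ 2 / 2, with value e ^ 2 - e ^ 4 / 4; e ^ 2 <= 2 makes l
    nonnegative. *)
Lemma error_scale n w r e : unitary n r -> 0 <= e -> e ^+ 2 <= 2 ->
  (exp_error w r <= e%:E)%E ->
  exists2 r', ratfun_deg_le n r' &
    (exp_error w r' <= (Num.sqrt (e ^+ 2 - e ^+ 4 / 4))%:E)%E.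
Proof.
move=> U e0 e2 /error_le err; have [[p [q [sp sq q0 rE]]] Uv] := U.
pose l : R := 1 - e ^+ 2 / 2.
have l0 : 0 <= l by rewrite /l; lra.
exists ((l%:C *: p)%:F / q%:F).
  by exists (l%:C *: p), q; split=> //; exact: leq_trans (size_scale_leq _ _) sp.
apply/error_le => x xI; have [reg d] := err x xI.
have [[v hv] n1] := Uv x.
(* The denominator [q] may vanish at this point through a common factor, so the value is computed
   from a fraction that is regular there. *)
have [p1 [q1 [q1x rE1 vE]]] := hv.
have q10 : q1 != 0 by apply: contra_neq q1x => ->; rewrite horner0.
have rE' : (l%:C *: p)%:F / q%:F = (l%:C *: p1)%:F / q1%:F :> ratfun R.
  apply/eqP; rewrite frac_eq// -!scalerAl; apply/eqP; congr (_ *: _).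
  by apply/eqP; rewrite -frac_eq// -rE -rE1.
have cls z a b (cop : coprimep a b) : b != 0 -> forall u, has_value (a%:F / b%:F : ratfun R) z u ->
    reval (a%:F / b%:F : ratfun R) z = u.
  move=> b0 u hu; have [bz ->] := has_value_reduced cop b0 erefl hu.
  exact: reval_reduced.
have reduce (f : ratfun R) z u m : ratfun_deg_le m f -> has_value f z u -> reval f z = u.
  by move=> /reduced_fraction[a [b [cop _ _ b0 ->]]]; exact: cls.
have rv : reval r (imag x) = v by apply: (reduce _ _ _ n) => //; case: U.
have hv' : has_value ((l%:C *: p)%:F / q%:F : ratfun R) (imag x) (l%:C * v).
  by exists (l%:C *: p1), q1; split=> //; rewrite vE hornerZ mulrA.
have rv' : reval ((l%:C *: p)%:F / q%:F : ratfun R) (imag x) = l%:C * v.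
  apply: (reduce _ _ _ n) => //; exists (l%:C *: p), q; split=> //.
  exact: leq_trans (size_scale_leq _ _) sp.
split; first by exists (l%:C * v).
rewrite rv'; rewrite rv in d n1.
have f1 := cabs_cexp w x; move: (cexp _) d f1 => f d f1.
have {}n1 : cabs v ^+ 2 = 1 by rewrite n1 expr1n.
have {}f1 : cabs f ^+ 2 = 1 by rewrite f1 expr1n.
have d2 : cabs (v - f) ^+ 2 <= e ^+ 2 by rewrite lerXn2r ?nnegrE ?cabs_ge0.
have E0 : 0 <= e ^+ 2 - e ^+ 4 / 4 by rewrite (exprM e 2 2); nra.
rewrite -(@ler_pXn2r _ 2) ?nnegrE ?cabs_ge0 ?sqrtr_ge0// sqr_sqrtr//.
have -> : cabs (l%:C * v - f) ^+ 2 = (1 - l) ^+ 2 + l * cabs (v - f) ^+ 2.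
  move: n1 f1; rewrite !sqr_cabs; case: (v) => a b; case: (f) => c g /= h1 h2.
  transitivity ((1 - l) ^+ 2 + l * ((a - c) ^+ 2 + (b - g) ^+ 2) +
    (l ^+ 2 - l) * (a ^+ 2 + b ^+ 2 - 1) + (1 - l) * (c ^+ 2 + g ^+ 2 - 1)).
    by ring.
  by rewrite h1 h2 !subrr !mulr0 !addr0.
have := ler_wpM2l l0 d2; rewrite (exprM e 2 2) /l.
by move: (e ^+ 2) (cabs _ ^+ 2) => E c; lra.
Qed.
End Errors.

(** * Frequencies from (n + 1) pi on, and frequency 0 *)

Section LargeFrequency.
Context {R : realType}.
Local Open Scope complex_scope.
Implicit Types (p q s : {poly R[i]}) (x w e : R) (r : ratfun R).

Lemma re_mul_sign (k : nat) (z : R[i]) : re ((-1) ^+ k * z) = (-1) ^+ k * re z.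
Proof.
by rewrite -!(signr_odd _ k); case: (odd k); rewrite ?expr0 ?mul1r// !expr1 !mulN1r; case: z.
Qed.

Lemma hexp_shift w x (k : nat) : w != 0 ->
  hexp w (x + k%:R * (2 * (pi / w))) = (-1) ^+ k * hexp w x.
Proof.
move=> w0; elim: k => [|k IH]; first by rewrite mul0r addr0 mul1r.
have -> : x + k.+1%:R * (2 * (pi / w)) = x + k%:R * (2 * (pi / w)) + 2 * (pi / w).
  by rewrite -natr1; ring.
rewrite [(-1) ^+ k.+1]exprS -mulrA -IH /hexp; move: (x + _) => y.
have -> : w * (y + 2 * (pi / w)) / 2 = w * y / 2 + pi by field.
rewrite cosDpi sinDpi.
by apply/eqP; rewrite eq_complex /=; apply/andP; split; apply/eqP; ring.
Qed.

Lemma hexp_sqr_shift w x (k : nat) : w != 0 ->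
  hexp w (x + k%:R * (pi / w)) ^+ 2 = (-1) ^+ k * hexp w x ^+ 2.
Proof.
move=> w0; elim: k => [|k IH]; first by rewrite mul0r addr0 mul1r.
have -> : x + k.+1%:R * (pi / w) = x + k%:R * (pi / w) + pi / w.
  by rewrite -natr1; ring.
rewrite [(-1) ^+ k.+1]exprS -mulrA -IH /hexp; move: (x + _) => y.
have -> : w * (y + pi / w) / 2 = w * y / 2 + pi / 2 by field.
rewrite cosDpihalf sinDpihalf.
by apply/eqP; rewrite eq_complex /=; apply/andP; split; apply/eqP; ring.
Qed.

Lemma node_in (m : nat) w (d : R) k : 0 < w -> 0 <= d -> m%:R * d <= 2 * w -> (k <= m)%N ->
  -1 <= -1 + k%:R * (d / w) <= 1.
Proof.
move=> w0 d0 dw km; have k0 : 0 <= k%:R * (d / w).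
  by rewrite mulr_ge0// divr_ge0// ltW.
have : k%:R * (d / w) <= 2.
  rewrite mulrA ler_pdivrMr//; apply: le_trans dw.
  by rewrite ler_wpM2r// ler_nat.
lra.
Qed.

(* At nodes 2 pi / w apart exp(- i w x / 2) changes sign, so Re twist s > 0
   forces n + 1 sign changes on a real polynomial of degree n. *)
Lemma unitary_error_ge2 n w r : 0 < w -> n.+1%:R * pi <= w -> unitary n r ->
  (2%:E <= exp_error w r)%E.
Proof.
move=> w0 wn U; rewrite leNgt; apply/negP => lt2.
have fin : exp_error w r \is a fin_num.
  by rewrite ge0_fin_numE ?error_ge0// (lt_le_trans lt2)// leey.
move: lt2 (error_ge0 w r); rewrite -(fineK fin); set e := fine _.
rewrite lte_fin lee_fin => e2 e0.
pose k := e / 2; have k01 : 0 <= k < 1 by rewrite /k; lra.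
(* At least k / sqrt (1 - k ^ 2), the slope that an error of 2 k requires. *)
pose t := k / (1 - k).
have t0 : 0 <= t by rewrite divr_ge0//; lra.
have tk : t * (1 - k) = k by rewrite divfK// gt_eqF//; lra.
have kt : k ^+ 2 * (1 + t ^+ 2) <= t ^+ 2.
  have E : t ^+ 2 * (1 - k) ^+ 2 = k ^+ 2 by rewrite -exprMn tk.
  have : 0 <= t ^+ 2 * (k * (1 - k)) by apply: mulr_ge0; [exact: sqr_ge0|apply: mulr_ge0; lra].
  rewrite -E; move: (t ^+ 2) (sqr_ge0 t) E => T T0 E; nra.
have err : (exp_error w r <= (2 * k)%:E)%E.
  by rewrite -(fineK fin) lee_fin /k mulrC divfK.
have [s [s0 sn _ rs]] := unitary_cone U k01 t0 kt err.
(* The constant is the exponential factor at the first node, so at node j this polynomial is (-1) ^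
   j Re twist s. There are n + 2 nodes for a size of at most n + 1. *)
pose G := re_poly (hexp w (-1) *: s).
have sG : (size G <= n.+1)%N.
  by rewrite (leq_trans (size_re_poly _))// (leq_trans (size_scale_leq _ _)).
have nI j : (j <= n.+1)%N -> -1 <= -1 + j%:R * (2 * pi / w) <= 1.
  apply: node_in => //; first by rewrite mulr_ge0// pi_ge0.
  by rewrite mulrCA ler_pM2l.
have GE j : (-1) ^+ j * G.[-1 + j%:R * (2 * pi / w)] = re (twist w s (-1 + j%:R * (2 * pi / w))).
  rewrite re_horner -re_mul_sign hornerZ [(-1) ^+ j * _]mulrA -[2 * pi / w]mulrA.
  by rewrite -hexp_shift ?gt_eqF// mulrC.
have G0 : G.[-1 + 0%:R * (2 * pi / w)] = 0.
  apply: (alternating_zero sG) => // j jn.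
  by rewrite GE ltW// rs// nI.
by have := rs _ (nI 0%N isT); rewrite -GE G0 mulr0 ltxx.
Qed.

(** Expanding |P - Q exp(i w x)| ^ 2 <= |Q| ^ 2 gives |P| ^ 2 <= 2 Re (P conj Q exp(- i w x)). At
    nodes pi / w apart the exponential alternates, so a real polynomial of degree at most 2 n
    alternates weakly at 2 n + 2 nodes. It vanishes at all of them, hence so does P, which has
    degree at most n. *)
Lemma cheb_zero n w r : 0 < w -> n.+1%:R * pi <= w -> ratfun_deg_le n r ->
  (exp_error w r <= 1%E)%E -> r = 0.
Proof.
move=> w0 wn /reduced_fraction[p [q [cop sp sq q0 ->]]].
move=> /(error_reduced _ _ cop q0) err.
set P := rotp 'i%C p in err; set Q := rotp 'i%C q in err.
have sP : (size P <= n.+1)%N by rewrite size_rotp// i_neq0.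
have sQ : (size Q <= n.+1)%N by rewrite size_rotp// i_neq0.
pose G := re_poly (hexp w (-1) ^+ 2 *: (P * conjp Q)).
pose N := n.*2.+1.
have sG : (size G <= N)%N.
  rewrite (leq_trans (size_re_poly _))// (leq_trans (size_scale_leq _ _))//.
  rewrite (leq_trans (size_polyMleq _ _))// size_conjp /N.
  by move: (size P) (size Q) sP sQ; clear; lia.
pose y j : R := -1 + j%:R * (pi / w).
have p0 := pi_gt0 R.
have nI j : (j <= N)%N -> -1 <= y j <= 1.
  apply: node_in => //; first exact: ltW.
  have : N%:R <= (2 * n.+1%:R : R) by rewrite -natrM ler_nat /N; lia.
  move=> h; have := ler_wpM2r (ltW p0) h; lra.
have GE j : (-1) ^+ j * G.[y j] = re (P.[(y j)%:C] * (Q.[(y j)%:C])^*%C * hexp w (y j) ^+ 2).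
  rewrite re_horner -re_mul_sign hornerZ hornerM horner_conjp [(-1) ^+ j * _]mulrA.
  by rewrite -hexp_sqr_shift ?gt_eqF// mulrC.
have pos x : -1 <= x <= 1 ->
    cabs P.[x%:C] ^+ 2 <= 2 * re (P.[x%:C] * (Q.[x%:C])^*%C * hexp w x ^+ 2).
  move=> /err[_]; rewrite mul1r.
  have := half_conj w x; rewrite /twist -/(hexp w x).
  move: P.[_] Q.[_] (hexp w x) (cabs_half w x) => a b c _ cc h.
  have : cabs (a * c - b * c^*%C) ^+ 2 <= cabs b ^+ 2 by rewrite lerXn2r ?nnegrE ?cabs_ge0.
  have c1 : re c ^+ 2 + im c ^+ 2 = 1.
    by move: cc => /(congr1 re); case: (c) => u v /= <-; ring.
  rewrite !sqr_cabs; move: c1; case: a {h} => a1 a2; case: b => b1 b2; case: c {cc} => u v /= c1 h.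
  rewrite -subr_ge0; move: h; rewrite -subr_ge0 => h.
  apply: le_trans h _; rewrite -subr_ge0 le_eqVlt; apply/orP; left; apply/eqP.
  transitivity (((a1 ^+ 2 + a2 ^+ 2) + (b1 ^+ 2 + b2 ^+ 2)) * (u ^+ 2 + v ^+ 2 - 1)).
    by rewrite c1 subrr mulr0.
  by rewrite expr2; ring.
have Gpos j : (j <= N)%N -> 0 <= (-1) ^+ j * G.[y j].
  move=> jN; rewrite GE; have := pos _ (nI j jN).
  have := sqr_ge0 (cabs P.[(y j)%:C]); lra.
have Gk := alternating_zero sG Gpos.
have Pz j : (j <= N)%N -> P.[(y j)%:C] = 0.
  move=> jN; have := pos _ (nI j jN); rewrite -GE (Gk j jN).
  rewrite mulr0 mulr0 => h; apply/eqP; rewrite -cabs_eq0 -sqrf_eq0.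
  by apply/eqP/le_anti; rewrite h sqr_ge0.
have P0 : P = 0.
  apply/eqP; apply: contraT => Pn0.
  have := @max_poly_roots _ P [seq (y j)%:C | j <- iota 0 N.+1] Pn0.
  rewrite size_map size_iota.
  have -> : all (root P) [seq (y j)%:C | j <- iota 0 N.+1].
    by apply/allP => _ /mapP[j jN ->]; apply/eqP/Pz; move: jN; rewrite mem_iota.
  have -> : uniq [seq (y j)%:C | j <- iota 0 N.+1].
    rewrite map_inj_uniq ?iota_uniq// => i j /complexI /addrI /mulIf.
    have -> : pi / w != 0 by rewrite mulf_neq0 ?invr_eq0 ?gt_eqF.
    by move=> /(_ isT) /eqP; rewrite eqr_nat => /eqP.
  move=> /(_ isT isT) h; have := leq_trans h sP.
  by rewrite /N -addnn; clear; lia.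
have -> : p = 0.
  by apply/eqP; rewrite -size_poly_eq0 -(size_rotp _ i_neq0) -/P P0 size_poly0.
by rewrite tofrac0 mul0r.
Qed.

Lemma error_zero_frequency n r : ratfun_deg_le n r -> (exp_error 0 r <= 0%E)%E -> r = 1.
Proof.
move=> /reduced_fraction[p [q [cop sp sq q0 ->]]] /(error_reduced _ _ cop q0) err.
have PQ : rotp 'i%C p = rotp 'i%C q.
  apply/eqP; rewrite -subr_eq0; apply/eqP/(@poly_eq0_itv R _ (-1) 1); first lra.
  move=> x /err[_]; rewrite mul0r => h.
  have /eqP : cabs (twist 0 (rotp 'i%C p) x - (rotp 'i%C q).[x%:C] * (hexp 0 x)^*%C) = 0.
    by apply/le_anti; rewrite h cabs_ge0.
  rewrite cabs_eq0 /twist conj_half !mul0r cos0 sin0 oppr0 hornerD hornerN.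
  by rewrite -[1 +i* 0]/(1 : R[i]) !mulr1 => /eqP.
have -> : p = q.
  by rewrite -[p](rotpK _ mul_Ni_i) -[q](rotpK _ mul_Ni_i) PQ.
by rewrite divff// tofrac_eq0.
Qed.

Lemma error_one : exp_error 0 (1 : ratfun R) = 0%E.
Proof.
apply/le_anti; rewrite error_ge0 andbT -const1.
apply/(error_reduced _ _ (coprimep1 _)); first by rewrite polyC_eq0 oner_eq0.
move=> x _; rewrite /rotp comp_polyC !hornerC oner_eq0; split=> //.
rewrite /twist conj_half !mul0r cos0 sin0 oppr0 hornerC -[1 +i* 0]/(1 : R[i]).
by rewrite mulr1 subrr ComplexField.Normc.normc0.
Qed.

End LargeFrequency.

(** * The two inequalities and the special frequencies *)

Unset Implicit Arguments.

Theorem theorem1 (R : realType) (n : nat) (omega : R) (homega : 0 <= omega) :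
  (0 < omega ->
     ((2^-1 : R)%:E * unitary_error n omega <= cheb_error n omega)%E /\
     (cheb_error n omega < unitary_error n omega)%E) /\
  (n.+1%:R * pi <= omega ->
     [/\ forall r : ratfun R, cheb_approximant n omega r <-> r = 0,
         cheb_error n omega = 1%E,
         forall r : ratfun R, unitary n r -> unitary_approximant n omega r &
         unitary_error n omega = 2%:E]) /\
  (omega = 0 ->
     [/\ forall r : ratfun R, cheb_approximant n omega r <-> r = 1,
         forall r : ratfun R, unitary_approximant n omega r <-> r = 1,
         unitary_error n omega = 0%E &
         cheb_error n omega = 0%E]).
Proof.
have cle r : ratfun_deg_le n r -> (cheb_error n omega <= exp_error omega r)%E.
  by move=> dr; apply: ereal_inf_lbound; exists r.
have ule r : unitary n r -> (unitary_error n omega <= exp_error omega r)%E.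
  by move=> U; apply: ereal_inf_lbound; exists r.
have c0 : (0 <= cheb_error n omega)%E.
  by apply: le_ereal_inf_tmp => _ [r _ <-]; exact: error_ge0.
have u0 : (0 <= unitary_error n omega)%E.
  by apply: le_ereal_inf_tmp => _ [r _ <-]; exact: error_ge0.
have d0 : ratfun_deg_le n (0 : ratfun R) by rewrite -const0; exact: deg_le_const.
have p0 := pi_gt0 R.
have large : n.+1%:R * pi <= omega ->
     [/\ forall r : ratfun R, cheb_approximant n omega r <-> r = 0,
         cheb_error n omega = 1%E,
         forall r : ratfun R, unitary n r -> unitary_approximant n omega r &
         unitary_error n omega = 2%:E].
  move=> wn; have w0 : 0 < omega by apply: lt_le_trans wn; rewrite mulr_gt0.
  have E1 : cheb_error n omega = 1%E.
    apply/le_anti/andP; split; first by have := cle _ d0; rewrite error0.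
    apply: le_ereal_inf_tmp => _ [r dr <-]; rewrite leNgt; apply/negP => lt1.
    by move: (lt1); rewrite (cheb_zero w0 wn dr (ltW lt1)) error0 ltxx.
  have eU r : unitary n r -> exp_error omega r = 2%:E.
    move=> U; apply/le_anti; rewrite (error_unitary_le2 _ U) /=.
    exact: unitary_error_ge2 wn U.
  have E2 : unitary_error n omega = 2%:E.
    apply/le_anti/andP; split; first by have := ule _ (unitary1 n); rewrite (eU _ (unitary1 n)).
    by apply: le_ereal_inf_tmp => _ [r U <-]; rewrite (eU _ U).
  split=> // [r|r U]; last by split=> //; rewrite eU.
  split=> [[dr er]|->]; last by split=> //; rewrite error0.
  by apply: (cheb_zero w0 wn dr); rewrite er E1.
split; [move=> w0|split=> // w0].
  have [wn|wn] := leP (n.+1%:R * pi) omega.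
    have [_ -> _ ->] := large wn; rewrite -EFinM mulVf ?pnatr_eq0//.
    by split; rewrite ?lexx// lte_fin ltr1n.
  have u2 : (unitary_error n omega <= 2%:E)%E.
    exact: le_trans (ule _ (unitary1 n)) (error_unitary_le2 _ (unitary1 n)).
  have ufin : unitary_error n omega \is a fin_num.
    by rewrite ge0_fin_numE// (le_lt_trans u2)// ltry.
  split.
    apply: le_ereal_inf_tmp => _ [r dr <-].
    have [rfin|] := boolP (exp_error omega r \is a fin_num); last first.
      by rewrite ge0_fin_numE ?error_ge0// -leNgt leye_eq => /eqP ->; rewrite leey.
    have e0 := error_ge0 omega r; rewrite -(fineK rfin) lee_fin in e0.
    have [|u U uE] := @unitary_twice_error R n omega _ r w0 wn e0 dr.
      by rewrite fineK.
    have := le_trans (ule _ U) uE; rewrite -(fineK ufin) -(fineK rfin) lee_fin => h.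
    by rewrite -EFinM lee_fin; lra.
  rewrite ltNge; apply/negP => uc.
  have [k k0 ku] := unitary_error_gt0 w0 wn.
  move: u2 uc ku; rewrite -(fineK ufin); set E := fine _ => u2 uc ku.
  rewrite !lee_fin in u2 ku.
  have E0 : 0 < E by lra.
  (* The zero function has error 1, and E is assumed not to exceed the Chebyshev error. *)
  have E1 : E <= 1 by have := le_trans uc (cle _ d0); rewrite error0 lee_fin.
  (* A unitary function with error e < E + E ^ 3 / 16 is close enough to optimal: scaled down, its
     squared error is at most E ^ 2 + E ^ 4 / 8 + E ^ 6 / 256 - E ^ 4 / 4, which is below E ^ 2
     since E <= 1. *)
  have d : 0 < E ^+ 3 / 16 by rewrite divr_gt0// exprn_gt0.
  have [_ [r U <-] lt] := lb_ereal_inf_adherent d ufin.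
  rewrite -[ereal_inf _]/(unitary_error n omega) -(fineK ufin) -/E -EFinD in lt.
  have rfin : exp_error omega r \is a fin_num.
    by rewrite ge0_fin_numE ?error_ge0// (lt_trans lt)// ltry.
  have := ule _ U; move: lt; rewrite -(fineK ufin) -(fineK rfin) -/E; set e := fine _.
  rewrite lte_fin lee_fin => lt Ee.
  have E3 : E ^+ 3 <= 1 by rewrite exprn_ile1// ltW.
  have e0 : 0 <= e by lra.
  have [||r' dr' er'] := @error_scale R n omega r e U e0.
  - by nra.
  - by rewrite /e fineK.
  have := le_trans uc (le_trans (cle _ dr') er'); rewrite lee_fin => h.
  (* [Num.sqrt] is 0 on negative arguments, so squaring it away requires the radicand to be
     nonnegative, which e ^ 2 <= 2 ensures. *)
  have {}h : E ^+ 2 <= e ^+ 2 - e ^+ 4 / 4.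
    rewrite -[X in _ <= X]sqr_sqrtr; first by rewrite lerXn2r ?nnegrE ?sqrtr_ge0// ltW.
    by have : e ^+ 2 <= 2; [nra|rewrite (exprM e 2 2); move: (sqr_ge0 e); nra].
  have h4 : E ^+ 4 <= e ^+ 4 by rewrite lerXn2r ?nnegrE// ltW.
  have h2 : e ^+ 2 <= (E + E ^+ 3 / 16) ^+ 2 by rewrite lerXn2r ?nnegrE; lra.
  have h6 : E ^+ 6 <= E ^+ 4 by rewrite ler_wiXn2l// ltW.
  have E4 : 0 < E ^+ 4 by rewrite exprn_gt0.
  have eq : (E + E ^+ 3 / 16) ^+ 2 = E ^+ 2 + E ^+ 4 / 8 + E ^+ 6 / 256 by field.
  lra.
have dr1 : ratfun_deg_le n (1 : ratfun R) by case: (unitary1 (R := R) n).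
have e1 : exp_error omega (1 : ratfun R) = 0%E by rewrite w0 error_one.
have E1 : unitary_error n omega = 0%E.
  by apply/le_anti; rewrite u0 andbT; have := ule _ (unitary1 n); rewrite e1.
have E2 : cheb_error n omega = 0%E by apply/le_anti; rewrite c0 andbT; have := cle _ dr1; rewrite e1.
split=> // r.
  split=> [[dr er]|->]; last by split=> //; rewrite e1.
  by apply: (error_zero_frequency dr); rewrite -w0 er E2.
split=> [[[dr _] er]|->]; last by split; [exact: unitary1|rewrite e1].
by apply: (error_zero_frequency dr); rewrite -w0 er E1.
Qed.
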